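(* Let $M^3\subset\mathbb{R}^5$ be a corank $1$ $3$-manifold at $p\in M^3$, with $p$ the origin, and let $j^2f(0)$ be the $2$-jet at $0$ of a local parametrisation $f:(\mathbb{R}^3,0)\to(\mathbb{R}^5,0)$ of $M^3$. Let $\Delta_{cv}$ be the curvature locus of $M^3$ at $p$, regarded as the union of the curvature parabolas at $p$ of the normal sections of $M^3$ along the tangent directions $w\in T_pM^3\setminus\{0\}$. Then: (i) if $j^2f(0)\sim_{\mathcal A^2}(x,y,xz,yz,z^2)$, then $\Delta_{cv}$ is generated exclusively by non-degenerate parabolas; (ii) if $j^2f(0)\sim_{\mathcal A^2}(x,y,z^2,xz,0)$, then $\Delta_{cv}$ is generated by non-degenerate parabolas and a half-line; (iii) if $j^2f(0)\sim_{\mathcal A^2}(x,y,xz,yz,0)$, then $\Delta_{cv}$ is generated exclusively by lines; (iv) if $j^2f(0)\sim_{\mathcal A^2}(x,y,z^2,0,0)$, then $\Delta_{cv}$ is generated exclusively by half-lines; (v) if $j^2f(0)\sim_{\mathcal A^2}(x,y,xz,0,0)$, then $\Delta_{cv}$ is generated by lines and a point; (vi) if $j^2f(0)\sim_{\mathcal A^2}(x,y,0,0,0)$, then $\Delta_{cv}$ is generated exclusively by points.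
   Context: Corank $1$ manifolds. A singular corank $1$ $n$-manifold $M\subset\mathbb{R}^m$ at $p$ (here $(n,m)=(3,5)$ or $(2,4)$) is the image of a smooth map $g:\tilde M\to\mathbb{R}^m$, where $\tilde M$ is a smooth $n$-manifold and $q\in\tilde M$, $g(q)=p$, is a point at which $dg_q$ has rank $n-1$. A local parametrisation $f$ is $g$ written in local coordinates of $\tilde M$ at $q$. Put $T_pM=\mathrm{Im}\,dg_q$ and $N_pM=(T_pM)^\perp\subset T_p\mathbb{R}^m$. The first fundamental form is $I(u,v)=\langle dg_q(u),dg_q(v)\rangle$ on $T_q\tilde M$. The second fundamental form $II:T_q\tilde M\times T_q\tilde M\to N_pM$ is the symmetric bilinear map with $II(\partial_{x_i},\partial_{x_j})=\pi_2(f_{x_ix_j})$ at the point corresponding to $q$, where $\pi_2:T_p\mathbb{R}^m\to N_pM$ is the orthogonal projection. Let $C_q=\{u\in T_q\tilde M: I(u,u)=1\}$ and $\eta(u)=II(u,u)$. The set $\eta(C_q)\subset N_pM$ is called the curvature locus $\Delta_{cv}$ when $n=3$ and the curvature parabola when $n=2$. The curvature parabola is always a non-degenerate parabola, a half-line, a line or a point. Normal section: for non-zero $w\in T_pM^3$ let $\{w=0\}$ be the hyperplane of $\mathbb{R}^5$ through $p$ orthogonal to $w$. The normal section of $M^3$ along $w$ is $M^3\cap\{w=0\}$, understood as the image of the restriction of $g$ to the regular surface $g^{-1}(\{w=0\})$ near $q$; it is a corank $1$ surface at $p$ in $\{w=0\}\cong\mathbb{R}^4$, whose normal space at $p$ inside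 $\{w=0\}$ is identified with $N_pM^3$. The curvature locus of $M^3$ at $p$ is the union of the curvature parabolas of its normal sections along all $w$. ''$\Delta_{cv}$ is generated exclusively by curves of a given type'' means that for every non-zero $w\in T_pM^3$ the curvature parabola at $p$ of the normal section along $w$ is of that type. ''Generated by curves of type A and a curve (or point) of type B'' means that the curvature parabola is of type B for exactly one direction $w$ (up to non-zero scalar multiples) and of type A for all other directions. $\mathcal A^2$-equivalence: two $2$-jets at $0$ of map germs $(\mathbb{R}^3,0)\to(\mathbb{R}^5,0)$ satisfy $j^2f(0)\sim_{\mathcal A^2}j^2h(0)$ if there are germs of diffeomorphisms $\varphi$ of $(\mathbb{R}^3,0)$ and $\psi$ of $(\mathbb{R}^5,0)$ with $j^2(\psi\circ f\circ\varphi^{-1})(0)=j^2h(0)$. *)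

(* Defs.v *)
From HB Require Import structures.
From mathcomp Require Import all_boot all_order all_algebra.
From mathcomp Require Import all_classical all_reals all_analysis.

Set Implicit Arguments.
Unset Strict Implicit.
Unset Printing Implicit Defensive.
Import Order.TTheory GRing.Theory Num.Theory.
Import numFieldNormedType.Exports.
Local Open Scope classical_set_scope.
Local Open Scope ring_scope.

(** A map germ at the origin is represented by a total function, of which only
    the behaviour near 0 matters.  Vectors are row vectors and a linear subspace
    of R^m is the row space of a matrix; since ['J F 0] acts on the right of row
    vectors, its row space is the image of the differential of F at 0. *)

Section Germs.
Context {R : realType}.

(* For open U.  In finite dimension, "differentiable with all directional
   derivatives of class C^k" is the usual class C^(k+1). *)
Fixpoint Ck n m (k : nat) (U : set 'rV[R]_n) (F : 'rV[R]_n -> 'rV[R]_m) : Prop :=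
  match k with
  | 0 => forall x, U x -> {for x, continuous F}
  | k'.+1 => (forall x, U x -> differentiable F x) /\
             (forall v, Ck k' U ('D_v F))
  end.

Definition smooth_germ n m (F : 'rV[R]_n -> 'rV[R]_m) : Prop :=
  exists U : set 'rV[R]_n, [/\ open U, U 0 & forall k, Ck k U F].

Definition partial n m (i : 'I_n) (F : 'rV[R]_n -> 'rV[R]_m) :
    'rV[R]_n -> 'rV[R]_m :=
  'D_(delta_mx 0 i) F.

(* The 2-jet at 0, given by its coefficients. *)
Definition jet2 n m (F : 'rV[R]_n -> 'rV[R]_m) :
    'rV[R]_m * ('I_n -> 'rV[R]_m) * ('I_n -> 'I_n -> 'rV[R]_m) :=
  (F 0, fun i => partial i F 0, fun i j => partial j (partial i F) 0).

(* [phi'] is the inverse germ of [phi]. *)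
Definition diffeo_germ n (phi phi' : 'rV[R]_n -> 'rV[R]_n) : Prop :=
  [/\ smooth_germ phi /\ smooth_germ phi',
      phi 0 = 0 /\ phi' 0 = 0,
      (\forall x \near (0 : 'rV[R]_n), phi' (phi x) = x)
    & (\forall x \near (0 : 'rV[R]_n), phi (phi' x) = x)].

Definition A2_equiv n m (f h : 'rV[R]_n -> 'rV[R]_m) : Prop :=
  exists (phi phi' : 'rV[R]_n -> 'rV[R]_n) (psi psi' : 'rV[R]_m -> 'rV[R]_m),
    [/\ diffeo_germ phi phi', diffeo_germ psi psi'
      & jet2 (psi \o f \o phi') = jet2 h].

End Germs.

Section CurvatureLocus.
Context {R : realType}.

Definition dot m (u v : 'rV[R]_m) : R := \sum_(i < m) u 0 i * v 0 i.

Definition orthc k m (A : 'M[R]_(k, m)) : 'M[R]_m := kermx A^T.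

(* [E] is the linear subspace of R^m in which the image of [F] is considered:
   the whole of R^5 for M^3, the hyperplane {w = 0} for a normal section. *)
Definition normal_space n m (E : 'M[R]_m) (F : 'rV[R]_n -> 'rV[R]_m) : 'M[R]_m :=
  (E :&: orthc ('J F 0))%MS.

Definition normal_proj n m (E : 'M[R]_m) (F : 'rV[R]_n -> 'rV[R]_m)
    (v : 'rV[R]_m) : 'rV[R]_m :=
  let N := normal_space E F in v *m proj_mx N (orthc N).

Definition first_ff n m (F : 'rV[R]_n -> 'rV[R]_m) (u v : 'rV[R]_n) : R :=
  dot ('d F 0 u) ('d F 0 v).

Definition second_ff n m (E : 'M[R]_m) (F : 'rV[R]_n -> 'rV[R]_m)
    (u v : 'rV[R]_n) : 'rV[R]_m :=
  \sum_(i < n) \sum_(j < n)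
    (u 0 i * v 0 j) *: normal_proj E F (partial j (partial i F) 0).

Definition curvature_locus n m (E : 'M[R]_m) (F : 'rV[R]_n -> 'rV[R]_m) :
    set 'rV[R]_m :=
  [set second_ff E F u u | u in [set u | first_ff F u u = 1]].

End CurvatureLocus.

Section NormalSections.
Context {R : realType}.
Implicit Types (f : 'rV[R]_3 -> 'rV[R]_5) (w : 'rV[R]_5).

Definition tangent_dir f w : Prop := w != 0 /\ (w <= 'J f 0)%MS.

(* [s] is the germ at 0 of a local parametrisation of the surface [S] near the
   origin: an immersion into [S] that is open onto the germ of [S] at 0. *)
Definition surface_param (S : set 'rV[R]_3) (s : 'rV[R]_2 -> 'rV[R]_3) : Prop :=
  [/\ smooth_germ s, s 0 = 0, \rank ('J s 0) = 2%N,
      (\forall t \near (0 : 'rV[R]_2), S (s t))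
    & forall U : set 'rV[R]_2, nbhs (0 : 'rV[R]_2) U ->
        \forall x \near (0 : 'rV[R]_3), S x -> (s @` U) x].

(* The curvature locus in {w = 0} of the restriction of [f] to the surface
   f^-1({w = 0}).  It does not depend on the local parametrisation [s]. *)
Definition section_parabola f w : set 'rV[R]_5 :=
  [set y | exists2 s, surface_param [set x | dot (f x) w = 0] s
                    & curvature_locus (orthc w) (f \o s) y].

Definition union_of_sections f : Prop :=
  curvature_locus 1%:M f = \bigcup_(w in tangent_dir f) section_parabola f w.

Definition generated_exclusively f (A : set 'rV[R]_5 -> Prop) : Prop :=
  union_of_sections f /\
  (forall w, tangent_dir f w -> A (section_parabola f w)).

(* [B] for exactly one direction [w0], up to scalar multiples, and [A] for all
   the others. *)
Definition generated_by f (A B : set 'rV[R]_5 -> Prop) : Prop :=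
  union_of_sections f /\
  exists2 w0, tangent_dir f w0 &
    forall w, tangent_dir f w ->
      (B (section_parabola f w) <-> (w <= w0)%MS) /\
      (~~ (w <= w0)%MS -> A (section_parabola f w)).

End NormalSections.

Section Curves.
Context {R : realType} {m : nat}.
Implicit Types (C : set 'rV[R]_m).

Definition nondegenerate_parabola C : Prop :=
  exists a b c : 'rV[R]_m, row_free (col_mx b c) /\
    C = [set a + t *: b + t ^+ 2 *: c | t in [set: R]].

Definition half_line C : Prop :=
  exists a b : 'rV[R]_m, b != 0 /\ C = [set a + t *: b | t in [set t : R | 0 <= t]].

Definition line C : Prop :=
  exists a b : 'rV[R]_m, b != 0 /\ C = [set a + t *: b | t in [set: R]].

Definition single_point C : Prop := exists a : 'rV[R]_m, C = [set a].

End Curves.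

(* The map (x, y, z) |-> G x y z, with G given by its list of components. *)
Definition map35 {R : realType} (G : R -> R -> R -> seq R) :
    'rV[R]_3 -> 'rV[R]_5 :=
  fun u => \row_(i < 5) (G (u 0 0) (u 0 1) (u 0 ord_max))`_i.

(* Main.v *)
(** Choose a generator [k] of the kernel of [df] and put, with values in the
    normal space, [II] for the second fundamental form.  The section along [w]
    sees exactly the vectors [u] with [df u] orthogonal to [w]; those with
    [I(u, u) = 1] are [c e + t k] with [c = 1] or [c = - 1], where [df e] is a
    unit vector of the tangent plane orthogonal to [w].  Hence its curvature
    locus is the curve [II(e, e) + 2 t II(e, k) + t ^+ 2 II(k, k)], whose type
    depends only on the linear relations between [II(k, e)] and [II(k, k)].

    The kernel of the linear map [u |-> II(k, u)] is carried along by changes of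
    coordinates: the second derivatives of the diffeomorphisms contribute only
    tangentially once one argument lies in the kernel of the differential.  So
    these relations can be read off from the normal form of the 2-jet.

    That a normal section is a parametrised surface at all is the implicit
    function theorem, proved here for one scalar equation by the intermediate
    value theorem; smoothness follows by bootstrapping the differential equation
    satisfied by the parametrisation. *)

Require Import Defs.
From HB Require Import structures.
From mathcomp Require Import all_boot all_order all_algebra.
From mathcomp Require Import all_classical all_reals all_analysis.
From mathcomp Require Import zify ring lra.
Import Order.TTheory GRing.Theory Num.Theory.
Import numFieldNormedType.Exports.
Local Open Scope classical_set_scope.
Local Open Scope ring_scope.

Set Implicit Arguments.
Unset Strict Implicit.

(** * Calculus of [Ck] maps *)

Section Differentiability.
Context {R : realType}.

(** The bound says that the remainder is little-o of [h]; uniqueness of the differential then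
    identifies it with [df]. *)
Lemma differentiableE (V W : normedModType R) (f : V -> W) (df : {linear V -> W}) (x : V) :
  continuous df ->
  (forall e : R, 0 < e -> \forall h \near (0 : V), `|f (h + x) - f x - df h| <= e * `|h|) ->
  differentiable f x /\ 'd f x = df :> (V -> W).
Proof.
move=> dfc fP.
have E : f \o shift x = cst (f x) + df +o_ 0 id.
  apply/eqaddoP => _/posnumP[e]; have := fP e%:num [gt0 of e%:num].
  by apply: filterS => h /=; rewrite opprD addrA.
have dfE : 'd f x = df :> (V -> W) by exact: diff_unique.
by split=> //; apply/diff_locallyP; rewrite dfE.
Qed.

Lemma differentiable_approx (V W : normedModType R) (f : V -> W) (x : V) :
  differentiable f x -> forall e : R, 0 < e ->
  \forall h \near (0 : V), `|f (h + x) - f x - 'd f x h| <= e * `|h|.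
Proof.
move=> /diff_locallyP[_ /eqaddoP fP] e e0.
by have := fP e e0; apply: filterS => h /=; rewrite opprD addrA.
Qed.

Lemma near_eq_differentiable (V W : normedModType R) (f g : V -> W) (x : V) :
  (\forall y \near x, f y = g y) -> differentiable f x -> differentiable g x.
Proof.
move=> fg df; apply: (proj1 (@differentiableE _ _ _ ('d f x) _ _ _)).
  exact: diff_continuous.
move=> e e0; have fgx := nbhs_singleton fg.
have fg0 : \forall h \near (0 : V), f (h + x) = g (h + x).
  by move: fg; rewrite (near_shift 0) /= subr0.
near=> h.
have <- : f (h + x) = g (h + x) by near: h.
by rewrite -fgx; near: h; exact: differentiable_approx.
Unshelve. all: by end_near. Qed.

Lemma differentiable_rowP (V : normedModType R) n (F : V -> 'rV[R]_n) (x : V) :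
  differentiable F x <-> forall j, differentiable (fun y => F y 0 j) x.
Proof.
split=> [dF j|dF].
  exact: (differentiable_comp dF (differentiable_coord _ 0 j)).
have -> : F = \sum_(j < n) (fun y => F y 0 j *: (delta_mx 0 j : 'rV[R]_n)).
  by rewrite funeqE => y; rewrite fct_sumE -row_sum_delta.
by apply: differentiable_sum => j; exact: differentiableZl.
Qed.

Lemma continuous_rowP (T : topologicalType) n (F : T -> 'rV[R]_n) (x : T) :
  {for x, continuous F} <-> forall j, {for x, continuous (fun y => F y 0 j)}.
Proof.
split=> [cF j|cF].
  exact: (continuous_comp cF (@coord_continuous _ _ _ 0 j _)).
apply/cvgrPdist_le => e e0; near=> y.
rewrite /Num.Def.normr/= mx_normrE (bigmax_le _ (ltW e0))//= => -[i j] _ /=.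
rewrite !mxE (ord1 i); move: j; near: y; apply: filter_forall => j.
by move/cvgrPdist_le: (cF j); exact.
Unshelve. all: by end_near. Qed.

Lemma derive_coord (V : normedModType R) n (F : V -> 'rV[R]_n) (x v : V) j :
  differentiable F x -> 'D_v F x 0 j = 'D_v (fun y => F y 0 j) x.
Proof. by move=> /diff_derivable/derive_mx ->; rewrite mxE. Qed.

Lemma derive_comp (V : normedModType R) n (W : normedModType R)
    (F : V -> 'rV[R]_n) (g : 'rV[R]_n -> W) (x v : V) :
  differentiable F x -> differentiable g (F x) ->
  'D_v (g \o F) x = \sum_(j < n) 'D_v F x 0 j *: 'D_(delta_mx 0 j) g (F x).
Proof.
move=> dF dg; rewrite deriveE; last exact: differentiable_comp.
rewrite diff_comp //= -(deriveE v dF) {1}(row_sum_delta ('D_v F x)) linear_sum.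
by apply: eq_bigr => j _; rewrite linearZ /= -deriveE.
Qed.

End Differentiability.

(** * Closure properties of scalar functions of class C^k *)

Section CkCalculus.
Context {R : realType} {n : nat}.
Implicit Types (U : set 'rV[R]_n) (f g : 'rV[R]_n -> R).

(** Scalar counterpart of [Ck], for which products and inverses make sense; [Ck_coordP] reduces [Ck]
    to it coordinate by coordinate. *)
Fixpoint Cks (k : nat) U f : Prop :=
  match k with
  | 0 => forall x, U x -> {for x, continuous f}
  | k'.+1 => (forall x, U x -> differentiable f x) /\
             (forall v, Cks k' U ('D_v f))
  end.

(** Derivatives at a point of the open set [U] depend only on values in [U]. This lets a derivative
    be replaced by an explicit formula valid on [U]. *)
Lemma Cks_ext k U f g : open U -> Cks k U f -> (forall x, U x -> f x = g x) ->
  Cks k U g.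
Proof.
move=> oU; elim: k f g => [|k IH] f g /= + fg; have nfg x : U x -> \forall y \near x, f y = g y by
  move=> Ux; have := open_nbhs_nbhs (conj oU Ux); apply: filterS => y; exact: fg.
  move=> cf x Ux; suff : g @ x --> f x by rewrite fg.
  exact: (cvg_trans (near_eq_cvg (nfg x Ux)) (cf x Ux)).
move=> [df Df]; split=> [x Ux|v].
  by apply: near_eq_differentiable (df x Ux); exact: nfg.
by apply: IH (Df v) _ => x Ux; apply: near_eq_derive; exact: nfg.
Qed.

Lemma CksW k U f : Cks k.+1 U f -> Cks k U f.
Proof.
elim: k f => [|k IH] f [df Df]; last by split=> // v; exact: IH (Df v).
by move=> x Ux; exact: differentiable_continuous (df x Ux).
Qed.

Lemma Cks_sub k U U' f : U' `<=` U -> Cks k U f -> Cks k U' f.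
Proof.
move=> UU'; elim: k f => [|k IH] f /=; first by move=> cf x /UU'; exact: cf.
by move=> [df Df]; split=> [x /UU'|v]; [exact: df|exact: IH].
Qed.

Lemma Cks_cst k U (c : R) : Cks k U (fun=> c).
Proof.
elim: k c => [|k IH] c /=; first by move=> x _; exact: cst_continuous.
split=> [x _|v]; first exact: differentiable_cst.
have -> : 'D_v (fun=> c) = (fun=> 0) :> ('rV[R]_n -> R) by apply/funext => x; exact: derive_cst.
exact: IH.
Qed.

Lemma CksD k U f g : open U -> Cks k U f -> Cks k U g -> Cks k U (fun x => f x + g x).
Proof.
move=> oU; elim: k f g => [|k IH] f g /=.
  by move=> cf cg x Ux; exact: (continuousD (cf x Ux) (cg x Ux)).
move=> [df Df] [dg Dg]; split=> [x Ux|v].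
  by apply: differentiableD; [exact: df|exact: dg].
apply: (Cks_ext oU (IH _ _ (Df v) (Dg v))) => x Ux.
by rewrite -[RHS]/('D_v (f + g) x) deriveD//; apply: diff_derivable; [exact: df|exact: dg].
Qed.

Lemma CksM k U f g : open U -> Cks k U f -> Cks k U g -> Cks k U (fun x => f x * g x).
Proof.
move=> oU; elim: k f g => [|k IH] f g.
  by move=> cf cg x Ux; exact: (continuousM (cf x Ux) (cg x Ux)).
move=> cf cg; have [df Df] := cf; have [dg Dg] := cg; split=> [x Ux|v].
  by apply: differentiableM; [exact: df|exact: dg].
have h := CksD oU (IH _ _ (CksW cf) (Dg v)) (IH _ _ (CksW cg) (Df v)).
apply: (Cks_ext oU h) => x Ux.
by rewrite -[RHS]/('D_v (f * g) x) deriveM//; apply: diff_derivable; [exact: df|exact: dg].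
Qed.

Lemma CksV k U f : open U -> (forall x, U x -> f x != 0) ->
  Cks k U f -> Cks k U (fun x => (f x)^-1).
Proof.
move=> oU f0; elim: k => [|k IH].
  by move=> cf x Ux; exact: (continuousV (f0 x Ux) (cf x Ux)).
move=> cf; have [df Df] := cf; split=> [x Ux|v].
  by apply: differentiableV; [exact: df|exact: f0].
(* The derivative of [f^-1] involves [f^-1] itself only up to order [k], where the induction
   hypothesis applies. *)
have iV := IH (CksW cf).
have h := CksM oU (CksM oU (@Cks_cst k U (-1)) (CksM oU iV iV)) (Df v).
apply: (Cks_ext oU h) => x Ux.
rewrite deriveV//; [|exact: f0|by apply: diff_derivable; exact: df].
by rewrite mulN1r /GRing.scale /= -exprVn expr2.
Qed.

Lemma Cks_sum k U m (F : 'I_m -> 'rV[R]_n -> R) : open U -> (forall i, Cks k U (F i)) ->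
  Cks k U (fun x => \sum_(i < m) F i x).
Proof.
move=> oU; elim: m F => [|m IH] F cF.
  by apply: (Cks_ext oU (Cks_cst k U 0)) => x _; rewrite big_ord0.
apply: (Cks_ext oU (CksD oU (IH _ (fun i => cF (widen_ord (leqnSn m) i))) (cF ord_max))) => x _.
by rewrite big_ord_recr.
Qed.

Lemma Ck_coordP m k U (F : 'rV[R]_n -> 'rV[R]_m) : open U ->
  Ck k U F <-> forall j, Cks k U (fun x => F x 0 j).
Proof.
move=> oU; elim: k F => [|k IH] F /=.
  split=> [cF j x Ux|cF x Ux]; first by have /continuous_rowP := cF x Ux; exact.
  by apply/continuous_rowP => j; exact: cF.
split=> [[dF DF] j|cF].
  split=> [x Ux|v]; first by have /differentiable_rowP := dF x Ux; exact.
  have /IH/(_ j) h := DF v; apply: (Cks_ext oU h) => x Ux.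
  by rewrite derive_coord//; exact: dF.
have dF x : U x -> differentiable F x.
  by move=> Ux; apply/differentiable_rowP => j; exact: (cF j).1.
split=> // v; apply/IH => j; apply: (Cks_ext oU ((cF j).2 v)) => x Ux.
by rewrite derive_coord//; exact: dF.
Qed.

End CkCalculus.

(** Induction on the order, for all [g] at once: the chain rule gives sums of products of
    derivatives of [F] with partial derivatives of [g] composed with [F], and the latter fall under
    the induction hypothesis. *)
Lemma Cks_comp {R : realType} n m k (U : set 'rV[R]_n) (V : set 'rV[R]_m)
    (F : 'rV[R]_n -> 'rV[R]_m) (g : 'rV[R]_m -> R) :
  open U -> (forall x, U x -> V (F x)) -> Ck k U F -> Cks k V g -> Cks k U (g \o F).
Proof.
move=> oU UV; elim: k g => [|k IH] g.
  by move=> cF cg x Ux; apply: continuous_comp; [exact: cF|exact/cg/UV].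
move=> cF [dg Dg]; have cF1 := (Ck_coordP _ _ oU).1 cF.
have {}IH h : Cks k V h -> Cks k U (h \o F).
  by apply: IH; apply/Ck_coordP => // j; exact: CksW.
have [dF DF] := cF; split=> [x Ux|v].
  by apply: differentiable_comp; [exact: dF|exact/dg/UV].
have h : Cks k U (fun x => \sum_(j < m) 'D_v F x 0 j * ('D_(delta_mx 0 j) g \o F) x).
  apply: Cks_sum => // j; apply: CksM => //; last exact/IH/Dg.
  by have /(Ck_coordP _ _ oU) := DF v; exact.
apply: (Cks_ext oU h) => x Ux.
by rewrite (derive_comp v (dF x Ux) (dg _ (UV x Ux))).
Qed.

(** * Implicit functions *)

Section ImplicitFunction.
Context {R : realType}.

Lemma linear_rV_continuous m (V : normedModType R) (f : {linear 'rV[R]_m -> V}) :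
  continuous f.
Proof.
move=> x; apply: differentiable_continuous.
have -> : (f : 'rV[R]_m -> V) = \sum_(j < m) (fun y : 'rV[R]_m => y 0 j *: f (delta_mx 0 j)).
  rewrite funeqE => y; rewrite fct_sumE {1}(row_sum_delta y) linear_sum.
  by apply: eq_bigr => j _; rewrite linearZ.
apply: differentiable_sum => j.
by apply: differentiableZl; exact: differentiable_coord.
Qed.

(** The sign change yields a zero by the intermediate value theorem and strict monotonicity makes it
    unique. For continuity, the signs of [H] at [y t - d] and [y t + d] persist for nearby
    parameters and trap the zero in between. *)
Lemma implicit_function (T : topologicalType) (U : set T) (H : T -> R -> R) (r : R) :
  open U -> 0 < r ->
  (forall t, U t -> {in `[- r, r] &, {homo H t : y z / y < z}}) ->
  (forall t, U t -> {within `[- r, r], continuous (H t)}) ->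
  (forall t, U t -> H t (- r) < 0 < H t r) ->
  (forall t y, U t -> y \in `[- r, r] -> {for t, continuous (H ^~ y)}) ->
  exists y : T -> R, forall t, U t ->
    [/\ y t \in `]- r, r[, H t (y t) = 0,
        (forall z, z \in `[- r, r] -> H t z = 0 -> z = y t) & {for t, continuous y}].
Proof.
move=> oU r0 Hinc Hcont Hsgn Hcont2.
have ex t : exists y, U t -> y \in `]- r, r[%R /\ H t y = 0.
  (* Outside [U] the value 0 is a mere default. *)
  have [Ut|nUt] := pselect (U t); last by exists 0.
  have /andP[Hn Hp] := Hsgn t Ut.
  have [||c] := @IVT R (H t) (- r) r 0 _ (Hcont t Ut).
  - by lra.
  - by rewrite ge_min le_max (ltW Hn) (ltW Hp) /= orbT.
  rewrite in_itv /= => /andP[c1 c2] Hc; exists c => _; split=> //.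
  rewrite in_itv /= !lt_neqAle c1 c2 !andbT; apply/andP; split.
    by apply/eqP => cE; move: Hn; rewrite cE Hc ltxx.
  by apply/eqP => cE; move: Hp; rewrite -cE Hc ltxx.
have [y yP] := choice ex.
have sub z : z \in `]- r, r[ -> z \in `[- r, r] by apply: subset_itv_oo_cc.
have uniq t z : U t -> z \in `[- r, r] -> H t z = 0 -> z = y t.
  move=> Ut zr Hz; have [/sub yr Hy] := yP t Ut.
  have [zy|yz|//] := ltgtP z (y t).
    by have := Hinc t Ut _ _ zr yr zy; rewrite Hz Hy ltxx.
  by have := Hinc t Ut _ _ yr zr yz; rewrite Hz Hy ltxx.
exists y => t Ut; have [yr Hy] := yP t Ut; split=> //; first by move=> z; exact: uniq.
apply/cvgrPdist_lt => e e0; move: (yr); rewrite in_itv /= => /andP[y1 y2].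
(* Half distances keep [y t - d] and [y t + d] inside the interval and make [d] strictly smaller
   than [e]. *)
pose d := Num.min (e / 2) (Num.min ((r - y t) / 2) ((y t + r) / 2)).
have [d0 de dr1 dr2] : [/\ 0 < d, d <= e / 2, d <= (r - y t) / 2 & d <= (y t + r) / 2].
  split.
  - by rewrite /d !lt_min; apply/and3P; split; lra.
  - by rewrite /d ge_min lexx.
  - by rewrite /d !ge_min lexx orbT.
  - by rewrite /d !ge_min lexx !orbT.
have yp : y t + d \in `[- r, r] by rewrite in_itv /=; apply/andP; split; lra.
have ym : y t - d \in `[- r, r] by rewrite in_itv /=; apply/andP; split; lra.
have Hp : 0 < H t (y t + d) by rewrite -Hy; apply: Hinc => //; [exact: sub|lra].
have Hm : H t (y t - d) < 0 by rewrite -Hy; apply: Hinc => //; [exact: sub|lra].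
near=> u.
have Uu : U u by near: u; exact: open_nbhs_nbhs.
have [/[dup] /sub yur + Hyu] := yP u Uu; rewrite in_itv /= => /andP[_ _].
have Hup : 0 < H u (y t + d).
  by near: u; exact: (Hcont2 t _ Ut yp _ (lt_nbhsr Hp)).
have Hum : H u (y t - d) < 0.
  by near: u; exact: (Hcont2 t _ Ut ym _ (lt_nbhsl Hm)).
have lt1 : y u < y t + d.
  rewrite ltNge le_eqVlt; apply/negP => /orP[/eqP E|lt]; first by move: Hup; rewrite E Hyu ltxx.
  by have := Hinc u Uu _ _ yp yur lt; rewrite Hyu; lra.
have lt2 : y t - d < y u.
  rewrite ltNge le_eqVlt; apply/negP => /orP[/eqP E|lt]; first by move: Hum; rewrite -E Hyu ltxx.
  by have := Hinc u Uu _ _ yur ym lt; rewrite Hyu; lra.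
by rewrite ltr_norml; apply/andP; split; lra.
Unshelve. all: by end_near. Qed.

(* With [X := s (h + t) - s t], the equation [g \o s = 0] makes ['d g (s t) X]
   negligible with respect to [X], hence [X] close to [S h]. *)
Lemma implicit_differentiable m n (g : 'rV[R]_n -> R) (s : 'rV[R]_m -> 'rV[R]_n)
    (S : {linear 'rV[R]_m -> 'rV[R]_n}) (v : 'rV[R]_n) (t : 'rV[R]_m) :
  {for t, continuous s} -> (\forall h \near t, g (s h) = 0) ->
  differentiable g (s t) ->
  (\forall h \near (0 : 'rV[R]_m), s (h + t) - s t - S h = 'd g (s t) (s (h + t) - s t) *: v) ->
  differentiable s t /\ 'd s t = S :> ('rV[R]_m -> 'rV[R]_n).
Proof.
move=> cs gs0 dg sS; apply: differentiableE; first exact: linear_rV_continuous.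
move=> e e0; have [L L0 SL] := linear_lipschitz (@linear_rV_continuous _ _ S).
(* The bound 1/2 allows [d * |X|] to be absorbed in [|X| <= L * |h| + d * |X|], so that
   [|X| <= 2 * L * |h|]; the other bound turns the error [d * |X|] into at most [e * |h|]. *)
pose d := Num.min (2^-1) (e / (2 * L)).
have d0 : 0 < d by rewrite lt_min invr_gt0 ltr0n divr_gt0 // mulr_gt0.
have dh : d <= 2^-1 by rewrite ge_min lexx.
have dL : d * (2 * L) <= e by rewrite -ler_pdivlMr ?mulr_gt0 // ge_min lexx orbT.
have v0 : 0 < `|v| + 1 by rewrite ltr_wpDl.
have gst0 := nbhs_singleton gs0.
have gs0' : \forall h \near (0 : 'rV[R]_m), g (s (h + t)) = 0.
  by move: gs0; rewrite (near_shift 0) /= subr0.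
(* Dividing by [|v| + 1] rather than [|v|] covers the case [v = 0]. *)
have approx : \forall h \near (0 : 'rV[R]_m),
   `|g (s (h + t)) - g (s t) - 'd g (s t) (s (h + t) - s t)|
     <= d / (`|v| + 1) * `|s (h + t) - s t|.
  have c0 : (s (h + t) - s t) @[h --> (0 : 'rV[R]_m)] --> (0 : 'rV[R]_n).
    have c1 : (s \o shift t) @ (0 : 'rV[R]_m) --> s t by rewrite cvg_comp_shift add0r.
    rewrite -(subrr (s t)); exact: cvgB c1 (cvg_cst (s t)).
  have dh1 : \forall h \near (0 : 'rV[R]_m),
      `|g (s (h + t) - s t + s t) - g (s t) - 'd g (s t) (s (h + t) - s t)|
        <= d / (`|v| + 1) * `|s (h + t) - s t|.
    exact: c0 _ (differentiable_approx dg (divr_gt0 d0 v0)).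
  by apply: filterS dh1 => h; rewrite subrK.
near=> h.
have -> : s (h + t) - s t - S h = 'd g (s t) (s (h + t) - s t) *: v by near: h.
have ss : s (h + t) - s t - S h = 'd g (s t) (s (h + t) - s t) *: v by near: h.
have : `|g (s (h + t)) - g (s t) - 'd g (s t) (s (h + t) - s t)|
     <= d / (`|v| + 1) * `|s (h + t) - s t| by near: h.
have -> : g (s (h + t)) = 0 by near: h.
rewrite gst0 subrr sub0r normrN normrZ => gX.
set X := s (h + t) - s t in ss gX *; set A := `|'d g (s t) X| in gX *.
have AX : A * `|v| <= d * `|X|.
  apply: (@le_trans _ _ (d / (`|v| + 1) * `|X| * (`|v| + 1))).
    by apply: ler_pM; rewrite ?normr_ge0 //; lra.
  by rewrite mulrAC divfK // gt_eqF.
have XS : `|X| <= L * `|h| + d * `|X|.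
  have -> : X = S h + 'd g (s t) X *: v by rewrite -ss addrC subrK.
  rewrite (le_trans (ler_normD _ _)) // lerD //.
  rewrite normrZ; have -> : S h + 'd g (s t) X *: v = X by rewrite -ss addrC subrK.
  exact: AX.
have dX : d * `|X| <= 2^-1 * `|X| by rewrite ler_wpM2r.
have X2 : `|X| <= 2 * L * `|h| by lra.
apply: (le_trans AX); apply: (@le_trans _ _ (d * (2 * L * `|h|))).
  by rewrite ler_pM2l.
by rewrite mulrA ler_wpM2r.
Unshelve. all: by end_near. Qed.

End ImplicitFunction.

(** * Regular level sets of one smooth function as graphs *)

Section ImplicitHypersurface.
Context {R : realType} {n : nat} (j : 'I_n.+1).
Implicit Types (g : 'rV[R]_n.+1 -> R) (t : 'rV[R]_n) (y : R) (x : 'rV[R]_n.+1).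

Local Notation B := (row' j 1%:M : 'M[R]_(n, n.+1)).
Local Notation e_j := (delta_mx 0 j : 'rV[R]_n.+1).

(** Multiplication by [B], the identity matrix without row [j], inserts a zero at position [j], and
    multiplication by its transpose deletes coordinate [j]. So the space is split into the remaining
    coordinates [t] and the [j]-th coordinate [y]. *)
Definition insert_coord t y : 'rV[R]_n.+1 := t *m B + y *: e_j.

Lemma insert_coordE t y : insert_coord t y 0 j = y.
Proof.
rewrite !mxE big1 => [|i _]; last by rewrite !mxE eq_sym (negPf (neq_lift j i)) mulr0.
by rewrite !eqxx mulr1 add0r.
Qed.

Lemma insert_coord_lift t y i : insert_coord t y 0 (lift j i) = t 0 i.
Proof.
rewrite !mxE (bigD1 i) //= big1 => [|k ki]; last first.
  by rewrite !mxE (inj_eq lift_inj) (negPf ki) mulr0.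
by rewrite !mxE eqxx mulr1 addr0 (eq_sym (lift j i)) (negPf (neq_lift j i)) /= mulr0 addr0.
Qed.

Lemma delete_coordE x i : (x *m B^T) 0 i = x 0 (lift j i).
Proof.
rewrite !mxE (bigD1 (lift j i)) //= big1 => [|k ki]; last first.
  by rewrite !mxE eq_sym (negPf ki) mulr0.
by rewrite !mxE eqxx mulr1 addr0.
Qed.

Lemma insert_coordK t y : insert_coord t y *m B^T = t.
Proof. by apply/rowP => i; rewrite delete_coordE insert_coord_lift. Qed.

Lemma delete_coordK x : insert_coord (x *m B^T) (x 0 j) = x.
Proof.
apply/rowP => i; case: (unliftP j i) => [k ->|->]; last exact: insert_coordE.
by rewrite insert_coord_lift delete_coordE.
Qed.

Lemma derive_line g (a v : 'rV[R]_n.+1) y :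
  'D_1 (fun z : R => g (a + z *: v)) y = 'D_v g (a + y *: v).
Proof.
rewrite /derive; set q1 := fun h => h^-1 *: _; set q2 := fun h => h^-1 *: _.
suff -> : q1 = q2 by [].
by apply/funext => h; rewrite /q1 /q2 /= [h%:A]mulr1 scalerDl addrCA.
Qed.

Lemma derivable_line g (a v : 'rV[R]_n.+1) y :
  differentiable g (a + y *: v) -> derivable (fun z : R => g (a + z *: v)) y 1.
Proof.
move=> dg; apply: diff_derivable.
exact: (@differentiable_comp _ _ _ _ (fun z : R => a + z *: v)).
Qed.

(** Used to fit a box in the variables [t] and [y] inside a given ball; the summand 1 in the
    constant makes the inequality strict. *)
Lemma insert_coord_norm : exists2 K, 0 < K &
  forall r t y, 0 < r -> `|t| < r -> `|y| <= r -> `|insert_coord t y| < K * r.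
Proof.
have [K K0 KB] := linear_lipschitz (@linear_rV_continuous R _ _ (mulmxr B)).
exists (K + `|e_j| + 1) => [|r t y r0 tr yr]; first by rewrite addr_gt0 // ltr_wpDr.
rewrite (le_lt_trans (ler_normD _ _)) // !mulrDl mul1r.
rewrite -[ltLHS]addr0 ler_ltD // lerD //.
  by rewrite (le_trans (KB t)) // ler_pM2l // ltW.
by rewrite normrZ mulrC ler_wpM2l.
Qed.

(* The parametrisation [s] satisfies ['D_w s t = slope g w (s t)], so its
   smoothness follows by bootstrapping. *)
Definition slope g (w : 'rV[R]_n) x : 'rV[R]_n.+1 :=
  w *m B - ('D_(w *m B) g x / 'D_(e_j) g x) *: e_j.

Lemma slope_Ck g (V : set 'rV[R]_n.+1) w k : open V -> Cks k.+1 V g ->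
  (forall x, V x -> 'D_(e_j) g x != 0) -> Ck k V (slope g w).
Proof.
move=> oV [_ Dg] Dg0; apply/Ck_coordP => // i.
have cq := CksM oV (Dg (w *m B)) (CksV oV Dg0 (Dg e_j)).
have h := CksD oV (@Cks_cst _ _ k V ((w *m B) 0 i))
  (CksM oV cq (@Cks_cst _ _ k V (- (e_j 0 i)))).
by apply: (Cks_ext oV h) => x _; rewrite /slope !mxE mulrN.
Qed.

(** The positive partial derivative makes [g] strictly increasing along the [j]-th axis, so near 0
    the level set is the graph of an implicit function [y]. That [s] is a graph map is recorded by
    [s t *m B^T = t], from which its rank is later deduced. *)
Lemma implicit_hypersurface g (W : set 'rV[R]_n.+1) :
  open W -> W 0 -> (forall k, Cks k W g) -> g 0 = 0 -> 0 < 'D_(e_j) g 0 ->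
  exists s : 'rV[R]_n -> 'rV[R]_n.+1,
    [/\ smooth_germ s, s 0 = 0, (forall t, s t *m B^T = t),
        (\forall t \near (0 : 'rV[R]_n), g (s t) = 0)
      & forall U : set 'rV[R]_n, nbhs (0 : 'rV[R]_n) U ->
        \forall x \near (0 : 'rV[R]_n.+1), g x = 0 -> (s @` U) x].
Proof.
move=> oW W0 gW g0 Dg0.
have [rho rho0 rhoP] : exists2 rho, 0 < rho &
    forall x, `|x| < rho -> W x /\ 0 < 'D_(e_j) g x.
  have nW : nbhs (0 : 'rV[R]_n.+1) W by exact: open_nbhs_nbhs.
  have cD : {for (0 : 'rV[R]_n.+1), continuous ('D_(e_j) g)} by apply: (gW 1%N).2.
  have nD : nbhs (0 : 'rV[R]_n.+1) [set x | 0 < 'D_(e_j) g x] by exact: cvgr_gt cD _ Dg0.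
  have /nbhs_ballP[rho /= rho0 sub] : nbhs (0 : 'rV[R]_n.+1) (W `&` [set x | 0 < 'D_(e_j) g x]).
    exact: filterI.
  by exists rho => // x xr; apply: sub; rewrite -ball_normE /= sub0r normrN.
pose V : set 'rV[R]_n.+1 := ball 0 rho.
have VE x : V x <-> `|x| < rho by rewrite /V -ball_normE /= sub0r normrN.
have oV : open V by exact: ball_open.
have VW : V `<=` W by move=> x /VE /rhoP[].
have gV k : Cks k V g := Cks_sub VW (gW k).
have DV x : V x -> 0 < 'D_(e_j) g x by move=> /VE /rhoP[].
have dV x : V x -> differentiable g x by exact: (gV 1%N).1.
have [K K0 KP] := insert_coord_norm.
(* With this radius the closed interval of values [y] stays over the ball [V], where [g] is smooth
   with positive partial derivative. *)
pose r := rho / K; have r0 : 0 < r by rewrite divr_gt0.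
have inV t y : `|t| < r -> `|y| <= r -> V (insert_coord t y).
  move=> tr yr; apply/VE; apply: lt_le_trans (KP r t y r0 tr yr) _.
  by rewrite mulrC divfK // gt_eqF.
pose H t y := g (insert_coord t y).
have inr y : (y \in `[- r, r]) = (`|y| <= r) by rewrite in_itv /= ler_norml.
have Hder t y : `|t| < r -> `|y| <= r -> derivable (H t) y 1 /\ 0 < 'D_1 (H t) y.
  move=> tr yr; have zV := inV t y tr yr; split; first exact/derivable_line/dV.
  by rewrite /H /insert_coord derive_line; exact: DV.
have Hcont t : `|t| < r -> {within `[- r, r], continuous (H t)}.
  move=> tr; apply: derivable_within_continuous => y; rewrite inr => yr.
  exact: (Hder t y tr yr).1.
have Hinc t : `|t| < r -> {in `[- r, r] &, {homo H t : y z / y < z}}.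
  move=> tr; have cl y : y \in `]- r, r[ -> `|y| <= r.
    by move=> yr; rewrite -inr; apply: subset_itv_oo_cc yr.
  apply: gtr0_derive1_lt_cc; last exact: Hcont.
    by move=> y /cl yr; exact: (Hder t y tr yr).1.
  by move=> y /cl yr; rewrite derive1E; exact: (Hder t y tr yr).2.
have cins y : continuous (insert_coord ^~ y).
  move=> t; apply/continuous_rowP => i.
  case: (unliftP j i) => [k ->|->].
    rewrite (_ : (fun _ => _) = fun t => t 0 k); first exact: coord_continuous.
    by apply/funext => u; rewrite insert_coord_lift.
  rewrite (_ : (fun _ => _) = fun=> y); first exact: cst_continuous.
  by apply/funext => u; rewrite insert_coordE.
have Hct t y : `|t| < r -> `|y| <= r -> {for t, continuous (H ^~ y)}.
  move=> tr yr; apply: (@continuous_comp _ _ _ (insert_coord ^~ y) g); first exact: cins.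
  exact/differentiable_continuous/dV/inV.
have n0 : `|0 : 'rV[R]_n| < r by rewrite normr0.
(* At [t = 0] the signs at both ends follow from monotonicity and [g 0 = 0]; continuity in [t]
   spreads them to a smaller ball. *)
have [d d0 dP] : exists2 d, 0 < d & forall t, `|t| < d ->
    `|t| < r /\ H t (- r) < 0 < H t r.
  have H00 : H 0 0 = 0 by rewrite /H /insert_coord mul0mx scale0r addr0.
  have [i0 ir iNr] : [/\ 0 \in `[- r, r], r \in `[- r, r] & - r \in `[- r, r]].
    by rewrite !inr normrN normr0 ger0_norm ltW.
  have Hr : 0 < H 0 r by rewrite -H00; apply: Hinc.
  have HNr : H 0 (- r) < 0 by rewrite -H00; apply: Hinc => //; rewrite oppr_lt0.
  have n1 : nbhs (0 : 'rV[R]_n) [set t | 0 < H t r].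
    by apply: (cvgr_gt _ (Hct 0 r n0 _)) => //; rewrite -inr.
  have n2 : nbhs (0 : 'rV[R]_n) [set t | H t (- r) < 0].
    by apply: (cvgr_lt _ (Hct 0 (- r) n0 _)) => //; rewrite -inr.
  have n3 : nbhs (0 : 'rV[R]_n) (ball 0 r) := nbhsx_ballx _ _ r0.
  have /nbhs_ballP[d /= d0 sub] : nbhs (0 : 'rV[R]_n)
      (ball 0 r `&` ([set t | H t (- r) < 0] `&` [set t | 0 < H t r])).
    exact: filterI n3 (filterI n2 n1).
  exists d => // t td.
  have [] : (ball 0 r `&` ([set t | H t (- r) < 0] `&` [set t | 0 < H t r])) t.
    by apply: sub; rewrite -ball_normE /= sub0r normrN.
  by rewrite -ball_normE /= sub0r normrN => -> [-> ->].
pose U : set 'rV[R]_n := ball 0 d.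
have UE t : U t <-> `|t| < d by rewrite /U -ball_normE /= sub0r normrN.
have oU : open U by exact: ball_open.
have Ur t : U t -> `|t| < r by move=> /UE /dP[].
have [||||y yP] := @implicit_function R _ U H r oU r0.
- by move=> t /Ur; exact: Hinc.
- by move=> t /Ur; exact: Hcont.
- by move=> t /UE /dP[].
- by move=> t y /Ur tr; rewrite inr; exact: Hct.
pose s t := insert_coord t (y t).
have yr t : U t -> `|y t| <= r.
  by move=> /yP[yr _ _ _]; rewrite -inr; apply: subset_itv_oo_cc yr.
have sV t : U t -> V (s t) by move=> Ut; apply: inV; [exact: Ur|exact: yr].
have gs t : U t -> g (s t) = 0 by case/yP.
have cs t : U t -> {for t, continuous s}.
  move=> /yP[_ _ _ cy]; apply/continuous_rowP => i.
  case: (unliftP j i) => [k ->|->].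
    rewrite (_ : (fun _ => _) = fun t => t 0 k); first exact: coord_continuous.
    by apply/funext => u; rewrite insert_coord_lift.
  rewrite (_ : (fun _ => _) = y) //.
  by apply/funext => u; rewrite insert_coordE.
have nU t : U t -> nbhs t U by move=> Ut; exact: open_nbhs_nbhs.
have ds t : U t -> differentiable s t /\ forall w, 'D_w s t = slope g w (s t).
  move=> Ut; have dg := dV _ (sV t Ut).
  have Sl : linear (slope g ^~ (s t)).
    move=> a u w; rewrite /slope !deriveE // mulmxDl -scalemxAl linearP /=.
    by rewrite mulrDl scalerDl scalerBr scalerA mulrA opprD addrACA.
  pose SlM := GRing.isLinear.Build _ _ _ _ _ Sl.
  pose S : {linear 'rV[R]_n -> 'rV[R]_n.+1} := HB.pack (slope g ^~ (s t)) SlM.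
  (* For an increment [X] of [s], the part in the remaining coordinates is [h *m B]. Solving ['d g X
     = 'D_(h *m B) g + (increment of y) * 'D_(e_j) g] for the increment of [y] shows that [X]
     differs from the slope by ['d g X / 'D_(e_j) g] times [e_j]. *)
  have [||dst dstE] := @implicit_differentiable R n n.+1 g s S
    (('D_(e_j) g (s t))^-1 *: e_j) t (cs t Ut) _ dg.
  - by apply: filterS (nU t Ut) => u /gs.
  - near=> h.
    have -> : s (h + t) - s t = h *m B + (y (h + t) - y t) *: e_j.
      by rewrite /s /insert_coord mulmxDl scalerBl opprD addrACA addrK.
    have -> : 'd g (s t) (h *m B + (y (h + t) - y t) *: e_j) =
        'D_(h *m B) g (s t) + (y (h + t) - y t) * 'D_(e_j) g (s t).
      by rewrite linearD linearZ /= !deriveE.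
    have D0 : 'D_(e_j) g (s t) != 0 by rewrite gt_eqF //; exact/DV/sV.
    rewrite [S h]/(slope g h (s t)) /slope opprB addrC addrA subrK -scalerDl.
    by rewrite scalerA mulrDl mulfK.
  - by split=> // w; rewrite deriveE // dstE.
exists s; split.
- exists U; split=> //; first by apply/UE; rewrite normr0.
  (* If [s] is of class C^k, so is its derivative, a smooth field evaluated along [s]; hence [s] is
     of class C^(k+1). *)
  elim=> [|k IH]; first exact: cs.
  split=> [t /ds[]//|w]; apply/Ck_coordP => // i.
  have Sk : Cks k V (fun x => slope g w x 0 i).
    apply/(Ck_coordP _ _ oV).1; apply: slope_Ck => // x /DV Dx; exact: lt0r_neq0.
  have h := Cks_comp oU sV IH Sk.
  by apply: (Cks_ext oU h) => t /ds[_ ->].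
- have U0 : U 0 by apply/UE; rewrite normr0.
  have [_ _ u _] := yP 0 U0.
  rewrite /s -(u 0) ?inr ?normr0 //; first by rewrite /insert_coord mul0mx scale0r addr0.
    exact: ltW.
  by rewrite /H /insert_coord mul0mx scale0r addr0.
- by move=> t; rewrite insert_coordK.
- by apply: filterS (nU 0 _) => [t /gs|] //; apply/UE; rewrite normr0.
(* A point [x] of the level set close to 0 gives a zero [x 0 j] of [H] at the parameter [x *m B^T];
   uniqueness of zeros identifies it with the point of the graph. *)
- move=> U' nU'.
  have cB : continuous (mulmxr B^T : 'rV[R]_n.+1 -> 'rV[R]_n).
    exact: linear_rV_continuous.
  have nUU : nbhs (mulmxr B^T (0 : 'rV[R]_n.+1)) (U `&` U').
    by rewrite linear0; apply: filterI => //; apply: nU; apply/UE; rewrite normr0.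
  have n1 := cB 0 _ nUU.
  have n2 : nbhs (0 : 'rV[R]_n.+1) [set x | `|x 0 j| < r].
    have cj : {for (0 : 'rV[R]_n.+1), continuous (fun x => x 0 j)} by exact: coord_continuous.
    have c0 : `|(0 : 'rV[R]_n.+1) 0 j| < r by rewrite mxE normr0.
    exact: cvgr_lt (cvg_norm cj) _ c0.
  near=> x => gx.
  have [/= Ux U'x] : (mulmxr B^T @^-1` (U `&` U')) x by near: x.
  have xr : `|x 0 j| < r by near: x.
  exists (x *m B^T) => //; have [_ _ u _] := yP _ Ux.
  rewrite /s -(u (x 0 j)) ?delete_coordK // ?inr ?ltW //.
  by rewrite /H delete_coordK.
Unshelve. all: by end_near. Qed.

End ImplicitHypersurface.

(** * Second-order jets *)

Section SecondOrder.
Context {R : realType}.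

(** Second derivatives are asked for at 0 only, which is what the 2-jet sees. *)
Definition C2_germ n m (F : 'rV[R]_n -> 'rV[R]_m) : Prop :=
  (\forall x \near (0 : 'rV[R]_n), differentiable F x) /\
  forall v, differentiable ('D_v F) 0.

Lemma smooth_germ_C2 n m (F : 'rV[R]_n -> 'rV[R]_m) : smooth_germ F -> C2_germ F.
Proof.
move=> [U [oU U0 /(_ 2%N)[dF DF]]]; split; last by move=> v; exact: (DF v).1.
by apply: filterS (open_nbhs_nbhs (conj oU U0)).
Qed.

Lemma C2_germ_differentiable n m (F : 'rV[R]_n -> 'rV[R]_m) :
  C2_germ F -> differentiable F 0.
Proof. by case=> /nbhs_singleton. Qed.

Definition hess n m (F : 'rV[R]_n -> 'rV[R]_m) (u v : 'rV[R]_n) : 'rV[R]_m :=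
  \sum_(i < n) \sum_(j < n) (u 0 i * v 0 j) *: partial j (partial i F) 0.

Lemma derive_partial n m (F : 'rV[R]_n -> 'rV[R]_m) (x v : 'rV[R]_n) :
  differentiable F x -> 'D_v F x = \sum_(i < n) v 0 i *: partial i F x.
Proof.
move=> dF; rewrite deriveE // {1}(row_sum_delta v) linear_sum.
by apply: eq_bigr => i _; rewrite linearZ /= /partial deriveE.
Qed.

Lemma derive_scale (V : normedModType R) m (a : V -> R) (b : V -> 'rV[R]_m) (x v : V) :
  differentiable a x -> differentiable b x ->
  differentiable (fun y => a y *: b y) x /\
  'D_v (fun y => a y *: b y) x = 'D_v a x *: b x + a x *: 'D_v b x.
Proof.
move=> da db; have dab : differentiable (fun y => a y *: b y) x.
  apply/differentiable_rowP => j.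
  rewrite (_ : (fun _ => _) = (a * (fun y => b y 0 j))).
    by apply: differentiableM => //; exact: (differentiable_rowP b x).1.
  by apply/funext => y; rewrite mxE.
split=> //; apply/rowP => j; rewrite derive_coord // !mxE derive_coord //.
rewrite (_ : (fun _ => _) = (a * (fun y => b y 0 j))).
  rewrite deriveM; first by rewrite addrC; congr (_ + _); exact: mulrC.
    exact: diff_derivable.
  by apply: diff_derivable; exact: (differentiable_rowP b x).1.
by apply/funext => y; rewrite mxE.
Qed.

Lemma derive_rV_sum (V : normedModType R) n m (h : 'I_n -> V -> 'rV[R]_m) (x v : V) :
  (forall i, differentiable (h i) x) ->
  differentiable (fun y => \sum_(i < n) h i y) x /\
  'D_v (fun y => \sum_(i < n) h i y) x = \sum_(i < n) 'D_v (h i) x.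
Proof.
move=> dh; have -> : (fun y => \sum_(i < n) h i y) = \sum_(i < n) h i.
  by apply/funext => y; rewrite fct_sumE.
split; first exact: differentiable_sum.
by apply: derive_sum => i; exact: diff_derivable.
Qed.

(** Close to 0 the derivative along [u] is a combination of partial derivatives with constant
    coefficients, which can be differentiated once more. *)
Lemma hessE n m (F : 'rV[R]_n -> 'rV[R]_m) (u v : 'rV[R]_n) :
  C2_germ F -> hess F u v = 'D_v ('D_u F) 0.
Proof.
move=> [dF DF]; pose G x := \sum_(i < n) u 0 i *: partial i F x.
have FG : \forall x \near (0 : 'rV[R]_n), 'D_u F x = G x.
  by apply: filterS dF => x; exact: derive_partial.
rewrite (near_eq_derive _ FG).
have [i|_ ->] := @derive_rV_sum _ n m (fun i x => u 0 i *: partial i F x) 0 v.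
  by apply: differentiableZ; exact: DF.
apply: eq_bigr => i _; rewrite deriveZ; last by apply: diff_derivable; exact: DF.
rewrite derive_partial; last exact: DF.
by rewrite scaler_sumr; apply: eq_bigr => j _; rewrite scalerA.
Qed.

(** Second-order chain rule: near 0 the derivative of [G \o F] along [u] is the sum over [j] of
    [('D_u F)_j] times the [j]-th partial of [G] along [F], and the product rule applied to each
    term gives the two summands. *)
Lemma hess_comp n m p (F : 'rV[R]_n -> 'rV[R]_m) (G : 'rV[R]_m -> 'rV[R]_p) :
  C2_germ F -> F 0 = 0 -> C2_germ G ->
  [/\ C2_germ (G \o F), 'J (G \o F) 0 = 'J F 0 *m 'J G 0
    & forall u v, hess (G \o F) u v =
        hess F u v *m 'J G 0 + hess G (u *m 'J F 0) (v *m 'J F 0)].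
Proof.
move=> C2F F0 C2G; have dF := C2_germ_differentiable C2F.
have dG := C2_germ_differentiable C2G.
have dGF0 : differentiable G (F 0) by rewrite F0.
pose T u (j : 'I_m) x := ('D_u F x) 0 j *: partial j G (F x).
have cF : {for (0 : 'rV[R]_n), continuous F} by exact: differentiable_continuous.
have dGF : \forall x \near (0 : 'rV[R]_n), differentiable G (F x).
  have nG : nbhs (F 0) [set y | differentiable G y] by rewrite F0; exact: C2G.1.
  exact: cF _ nG.
have DGF u : \forall x \near (0 : 'rV[R]_n), 'D_u (G \o F) x = \sum_(j < m) T u j x.
  near=> x; rewrite derive_comp //; first by near: x; exact: C2F.1.
  by near: x.
have dT u v j : differentiable (T u j) 0 /\ 'D_v (T u j) 0 =
    (hess F u v) 0 j *: partial j G 0 +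
    (u *m 'J F 0) 0 j *: 'D_(v *m 'J F 0) (partial j G) 0.
  have dDF := C2F.2 u.
  have dDFj : differentiable (fun x => 'D_u F x 0 j) 0.
    exact: (differentiable_rowP ('D_u F) 0).1.
  have dDG : differentiable (partial j G) (F 0) by rewrite F0; exact: C2G.2.
  have [d1 ->] := @derive_scale _ _ (fun x => 'D_u F x 0 j) (partial j G \o F) 0 v
    dDFj (differentiable_comp dF dDG).
  split; first exact: d1.
  have -> : 'D_v (fun x => 'D_u F x 0 j) 0 = hess F u v 0 j.
    by rewrite (hessE u v C2F); exact/esym/(derive_coord v j dDF).
  have -> : 'D_v (partial j G \o F) 0 = 'D_(v *m 'J F 0) (partial j G) 0.
    rewrite (deriveE _ (differentiable_comp dF dDG)) (diff_comp dF dDG) /=.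
    by rewrite -(deriveE v dF) -(deriveE _ dDG) (deriveEjacobian _ dF) F0.
  by rewrite (deriveEjacobian _ dF) /comp F0.
have dDGF u : differentiable ('D_u (G \o F)) 0.
  apply: near_eq_differentiable (_ : differentiable (fun x => \sum_(j < m) T u j x) 0).
    by apply: filterS (DGF u) => x ->.
  by apply: (derive_rV_sum 0 _).1 => j; exact: (dT u 0 j).1.
have C2GF : C2_germ (G \o F).
  split=> //; near=> x; apply: differentiable_comp; last by near: x.
  by near: x; exact: C2F.1.
split=> // [|u v].
  apply/row_matrixP => i; rewrite !rowE mulmxA -!deriveEjacobian //; last first.
    exact: differentiable_comp.
  rewrite deriveE; last exact: differentiable_comp.
  by rewrite diff_comp //= -(deriveE _ dF) -deriveE // F0.
rewrite hessE // (near_eq_derive _ (DGF u)).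
have [j|_ ->] := @derive_rV_sum _ m p (T u) 0 v; first exact: (dT u v j).1.
rewrite (eq_bigr _ (fun j _ => (dT u v j).2)) big_split /=; congr (_ + _).
  rewrite mulmx_sum_row; apply: eq_bigr => j _.
  by rewrite rowE -deriveEjacobian.
rewrite /hess; apply: eq_bigr => i _; rewrite derive_partial; last exact: C2G.2.
by rewrite scaler_sumr; apply: eq_bigr => j _; rewrite scalerA.
Unshelve. all: by end_near. Qed.

End SecondOrder.

(** * Orthogonal projections *)

Section Orthogonality.
Context {R : realType} {m : nat}.
Implicit Types (u v w : 'rV[R]_m).

Lemma dotE u v : dot u v = (u *m v^T) 0 0.
Proof. by rewrite mxE; apply: eq_bigr => i _; rewrite mxE. Qed.

Lemma dot_eq0 u v : (dot u v = 0) <-> (u *m v^T = 0).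
Proof.
split=> [uv|uv]; last by rewrite dotE uv mxE.
by apply/matrixP => i k; rewrite !ord1 -dotE uv mxE.
Qed.

Lemma dotC u v : dot u v = dot v u.
Proof. by apply: eq_bigr => i _; rewrite mulrC. Qed.

Lemma dot_ge0 u : 0 <= dot u u.
Proof. by apply: sumr_ge0 => i _; exact: sqr_ge0. Qed.

Lemma dot_self_eq0 u : dot u u = 0 -> u = 0.
Proof.
move/eqP; rewrite psumr_eq0 => [/allP uu|i _]; last exact: sqr_ge0.
apply/rowP => i; have := uu i (mem_index_enum i).
by rewrite /= mulf_eq0 orbb mxE => /eqP.
Qed.

Lemma dotZ (a b : R) u v : dot (a *: u) (b *: v) = a * b * dot u v.
Proof. by rewrite !dotE linearZ /= -scalemxAl -scalemxAr scalerA mxE. Qed.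

Lemma sub_orthc k l (A : 'M[R]_(k, m)) (B : 'M[R]_(l, m)) :
  (A <= orthc B)%MS = (A *m B^T == 0).
Proof. exact: sub_kermx. Qed.

Lemma sub_orthcC k l (A : 'M[R]_(k, m)) (B : 'M[R]_(l, m)) :
  (A <= orthc B)%MS = (B <= orthc A)%MS.
Proof. by rewrite !sub_orthc -(inj_eq trmx_inj) trmx_mul trmxK trmx0. Qed.

Lemma rank_orthc k (A : 'M[R]_(k, m)) : \rank (orthc A) = (m - \rank A)%N.
Proof. by rewrite mxrank_ker mxrank_tr. Qed.

Lemma orthcS k l (A : 'M[R]_(k, m)) (B : 'M[R]_(l, m)) :
  (A <= B)%MS -> (orthc B <= orthc A)%MS.
Proof.
by move=> AB; rewrite sub_orthcC; apply: submx_trans AB _; rewrite sub_orthcC.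
Qed.

Lemma orthcK k (A : 'M[R]_(k, m)) : (orthc (orthc A) :=: A)%MS.
Proof.
have sAA : (A <= orthc (orthc A))%MS by rewrite sub_orthcC.
apply/eqmxP; rewrite sAA andbT -(geq_leqif (mxrank_leqif_sup sAA)).
by rewrite !rank_orthc subKn // rank_leq_col.
Qed.

(** A common vector is orthogonal to itself, and the dot product is positive definite over the
    reals. *)
Lemma cap_orthc k (A : 'M[R]_(k, m)) : (A :&: orthc A)%MS = 0.
Proof.
apply/eqP; rewrite -submx0; apply/rV_subP => u; rewrite sub_capmx => /andP[uA uN].
have /eqP : u *m u^T == 0.
  by rewrite -sub_orthc; apply: submx_trans uA _; rewrite sub_orthcC.
by move/dot_eq0/dot_self_eq0 => ->; rewrite sub0mx.
Qed.

Lemma add_orthc k (A : 'M[R]_(k, m)) : (1%:M <= A + orthc A)%MS.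
Proof.
rewrite sub1mx /row_full mxrank_disjoint_sum ?cap_orthc // rank_orthc.
by rewrite subnKC // rank_leq_col.
Qed.

Definition orth_proj (N : 'M[R]_m) : 'M[R]_m := proj_mx N (orthc N).

Lemma orth_proj_uniq (N : 'M[R]_m) v p :
  (p <= N)%MS -> (v - p <= orthc N)%MS -> v *m orth_proj N = p.
Proof.
move=> pN vpN; rewrite -[v in LHS](subrK p) mulmxDl.
by rewrite proj_mx_0 ?cap_orthc // proj_mx_id ?cap_orthc // add0r.
Qed.

Lemma orth_proj_sub (N : 'M[R]_m) v : (v *m orth_proj N <= N)%MS.
Proof. exact: proj_mx_sub. Qed.

Lemma orth_proj_compl (N : 'M[R]_m) v : (v - v *m orth_proj N <= orthc N)%MS.
Proof.
by apply: proj_mx_compl_sub; apply: submx_trans (add_orthc N); exact: submx1.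
Qed.

Lemma orth_proj_eq0 (N : 'M[R]_m) v : v *m orth_proj N = 0 <-> (v <= orthc N)%MS.
Proof.
split=> [v0|vN]; first by have := orth_proj_compl N v; rewrite v0 subr0.
by apply: orth_proj_uniq; rewrite ?sub0mx // subr0.
Qed.

(** Row spaces are represented by many matrices; the projection matrix depends only on the space. *)
Lemma eq_orth_proj (N N' : 'M[R]_m) : (N :=: N')%MS -> orth_proj N = orth_proj N'.
Proof.
move=> NN'; apply/row_matrixP => i; rewrite !rowE.
apply: orth_proj_uniq; first by rewrite NN' orth_proj_sub.
by rewrite (submx_trans (orth_proj_compl N' _)) // orthcS // NN'.
Qed.

End Orthogonality.

(** * Orthogonality within a two-dimensional space *)

Section Plane.
Context {R : realType} {k m : nat} (J : 'M[R]_(k, m)).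
Hypothesis J2 : \rank J = 2%N.
Implicit Types (a b w : 'rV[R]_m).

(** Since [J] contains [w], the sum of [J] and the complement of [w] is the whole space; the
    dimension formula gives 2 + (m - 1) - m = 1. *)
Lemma rank_cap_orthc w : w != 0 -> (w <= J)%MS -> \rank (J :&: orthc w) = 1%N.
Proof.
move=> w0 wJ; have rw : \rank w = 1%N by rewrite rank_rV w0.
(* Ensures that the truncated difference [m - 1] is the true one. *)
have m1 : (0 < m)%N.
  by rewrite lt0n; apply/eqP => m0; move: (rank_leq_col w); rewrite rw m0.
have full : \rank (J + orthc w)%MS = m.
  apply/eqP; rewrite -[_ == _]/(row_full _) -sub1mx.
  by rewrite (submx_trans (add_orthc w)) // addsmxS.
by have := mxrank_sum_cap J (orthc w); rewrite full J2 rank_orthc rw; lia.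
Qed.

Lemma plane_collinear w a b : w != 0 -> (w <= J)%MS -> (a <= J)%MS -> dot a w = 0 ->
  (b <= J)%MS -> dot b w = 0 -> b != 0 -> (a <= b)%MS.
Proof.
move=> w0 wJ aJ aw bJ bw b0; have r1 := rank_cap_orthc w0 wJ.
have sub c : (c <= J)%MS -> dot c w = 0 -> (c <= J :&: orthc w)%MS.
  by move=> cJ /dot_eq0 cw; rewrite sub_capmx cJ sub_orthc cw eqxx.
apply: submx_trans (sub a aJ aw) _.
by have := mxrank_leqif_sup (sub b bJ bw) => /leqifP; rewrite r1 rank_rV b0; case: ifP.
Qed.

Lemma plane_orthogonal w : w != 0 -> (w <= J)%MS ->
  exists b, [/\ (b <= J)%MS, dot b w = 0 & b != 0].
Proof.
move=> w0 wJ; have r1 := rank_cap_orthc w0 wJ.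
pose b := nz_row (J :&: orthc w)%MS.
have bS : (b <= J :&: orthc w)%MS by exact: nz_row_sub.
exists b; split; first exact: submx_trans bS (capmxSl _ _).
- by apply/dot_eq0/eqP; rewrite -sub_orthc; exact: submx_trans bS (capmxSr _ _).
- by rewrite nz_row_eq0 -mxrank_eq0 r1.
Qed.

End Plane.

(** * Normal sections *)

Section NormalSectionLocus.
Context {R : realType}.

(* [Defs.normal_space] is shadowed by the topological notion. *)
Lemma second_ffE n m (E : 'M[R]_m) (F : 'rV[R]_n -> 'rV[R]_m) (u v : 'rV[R]_n) :
  second_ff E F u v = hess F u v *m orth_proj (Defs.normal_space E F).
Proof.
rewrite /second_ff /hess mulmx_suml; apply: eq_bigr => i _.
by rewrite mulmx_suml; apply: eq_bigr => j _; rewrite -scalemxAl.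
Qed.

Lemma first_ffE n m (F : 'rV[R]_n -> 'rV[R]_m) (u v : 'rV[R]_n) :
  first_ff F u v = dot (u *m 'J F 0) (v *m 'J F 0).
Proof. by rewrite /first_ff /jacobian !mul_rV_lin1. Qed.

Lemma derive_dot n m (F : 'rV[R]_n -> 'rV[R]_m) (w : 'rV[R]_m) (x v : 'rV[R]_n) :
  differentiable F x ->
  differentiable (fun y => dot (F y) w) x /\
  'D_v (fun y => dot (F y) w) x = dot ('D_v F x) w.
Proof.
move=> dF; pose h (i : 'I_m) (y : 'rV[R]_n) : R := w 0 i * F y 0 i.
have hE : (fun y => dot (F y) w) = \sum_(i < m) h i.
  apply/funext => y; rewrite fct_sumE; apply: eq_bigr => i _; exact: mulrC.
have dFi i : differentiable (fun y => F y 0 i) x by exact: (differentiable_rowP F x).1.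
have dh i : differentiable (h i) x by exact: differentiableZ.
rewrite hE; split; first exact: differentiable_sum.
rewrite derive_sum; last by move=> i; exact: diff_derivable.
apply: eq_bigr => i _; rewrite derive_coord // mulrC.
by rewrite -[RHS]/(w 0 i *: _) -deriveZ //; exact: diff_derivable.
Qed.

Lemma dot_Ck n m (U : set 'rV[R]_n) (F : 'rV[R]_n -> 'rV[R]_m) (w : 'rV[R]_m) k :
  open U -> Ck k U F -> Cks k U (fun x => dot (F x) w).
Proof.
move=> oU cF; apply: Cks_sum => // i; apply: CksM => //; last exact: Cks_cst.
exact: (Ck_coordP _ _ oU).1.
Qed.

Variables (f : 'rV[R]_3 -> 'rV[R]_5).
Hypotheses (f_smooth : smooth_germ f) (f0 : f 0 = 0) (f_rank : \rank ('J f 0) = 2%N).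
Local Notation J := ('J f 0).

(** Orthogonal projection onto the normal space of the 3-manifold, whose kernel is the tangent
    plane. *)
Definition normal_part : 'M[R]_5 := orth_proj (orthc J).

Lemma normal_part_eq0 (v : 'rV[R]_5) : v *m normal_part = 0 <-> (v <= J)%MS.
Proof. by rewrite orth_proj_eq0 orthcK. Qed.

Lemma curvature_locusE :
  curvature_locus 1%:M f =
  [set hess f u u *m normal_part | u in [set u | dot (u *m J) (u *m J) = 1]].
Proof.
have NE : orth_proj (Defs.normal_space 1%:M f) = normal_part.
  by rewrite /Defs.normal_space cap1mx.
rewrite eqEsubset; split=> _ [u /= uI <-]; exists u => //=.
- by rewrite -first_ffE.
- by rewrite second_ffE NE.
- by rewrite first_ffE.
- by rewrite second_ffE NE.
Qed.

(** The differential of [dot (f x) w] at 0 is [J *m w^T]. It is nonzero: as [w] lies in the row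
    space of [J], its vanishing would make [w] orthogonal to itself. *)
Lemma surface_param_exists w : tangent_dir f w ->
  exists s, surface_param [set x | dot (f x) w = 0] s.
Proof.
case=> w0 /submxP[a wE]; have [U [oU U0 fU]] := f_smooth.
have df : differentiable f 0 := C2_germ_differentiable (smooth_germ_C2 f_smooth).
have Dg v j : 'D_(delta_mx 0 j) (fun x => dot (f x) v) 0 = (J *m v^T) j 0.
  by rewrite (derive_dot _ _ df).2 deriveEjacobian // dotE -rowE -row_mul mxE.
have [j [c [c0 Dc]]] : exists j c, c != 0 /\
    0 < 'D_(delta_mx 0 j) (fun x => dot (f x) (c *: w)) 0.
  have [j Jj] : exists j, (J *m w^T) j 0 != 0.
    apply/existsP; apply: contraNT w0 => /existsPn Jw.
    have Jw0 : J *m w^T = 0.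
      by apply/colP => i; have := Jw i; rewrite negbK => /eqP ->; rewrite mxE.
    by apply/eqP/dot_self_eq0/dot_eq0; rewrite {1}wE -mulmxA Jw0 mulmx0.
  (* Scaling [w] by the nonzero derivative turns the derivative into a square, hence positive, and
     keeps the level set. *)
  exists j, ((J *m w^T) j 0); split=> //.
  by rewrite Dg linearZ /= -scalemxAr mxE lt_neqAle eq_sym mulf_neq0 // sqr_ge0.
have gE x : dot (f x) (c *: w) = c * dot (f x) w.
  by rewrite -[f x in LHS]scale1r dotZ mul1r.
have [k|||s [s_smooth s0 sB gs sU]] :=
    @implicit_hypersurface R 2 j (fun x => dot (f x) (c *: w)) U oU U0.
- exact: dot_Ck.
- by rewrite f0 dotE mul0mx mxE.
- exact: Dc.
have z x : dot (f x) (c *: w) = 0 <-> dot (f x) w = 0.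
  by rewrite gE; split=> [/eqP|->]; rewrite ?mulr0 // mulf_eq0 (negPf c0) => /eqP.
exists s; split=> //.
- have ds := C2_germ_differentiable (smooth_germ_C2 s_smooth).
  (* Deleting coordinate [j] undoes [s], so the deletion matrix is a right inverse of ['J s 0]. *)
  apply/eqP; rewrite -[_ == _]/(row_free _); apply/row_freeP; exists (row' j 1%:M)^T.
  apply/row_matrixP => i; apply/rowP => l; rewrite rowE mulmxA -deriveEjacobian //.
  rewrite delete_coordE derive_coord //.
  have -> : (fun y => s y 0 (lift j l)) = (fun y : 'rV[R]_2 => y 0 l).
    by apply/funext => t; rewrite -delete_coordE sB.
  by rewrite -(@derive_coord _ _ _ id) // derive_id row1 mxE.
- by apply: filterS gs => t /z.
- by move=> V nV; apply: filterS (sU V nV) => x xV /z.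
Qed.

(** The image of the differential of [s] consists of all [u] with [df u] orthogonal to [w], and the
    second derivatives of [s] contribute only tangentially. Hence the locus of the section is
    expressed by [f] and [w] alone. *)
Lemma section_parabolaE w : tangent_dir f w ->
  section_parabola f w =
  [set hess f u u *m normal_part |
     u in [set u | dot (u *m J) w = 0 /\ dot (u *m J) (u *m J) = 1]].
Proof.
move=> wT; have [w0 wJ] := wT; have f2 := smooth_germ_C2 f_smooth.
have key s : surface_param [set x | dot (f x) w = 0] s ->
    [/\ (forall a, dot (a *m 'J s 0 *m J) w = 0),
        (forall a, first_ff (f \o s) a a = dot (a *m 'J s 0 *m J) (a *m 'J s 0 *m J))
      & forall a, second_ff (orthc w) (f \o s) a a =
          hess f (a *m 'J s 0) (a *m 'J s 0) *m normal_part].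
  move=> [s_smooth s0 rs sS _]; have s2 := smooth_germ_C2 s_smooth.
  have [fs2 JE HE] := hess_comp s2 s0 f2.
  have sw a : dot (a *m 'J s 0 *m J) w = 0.
    have dfs := C2_germ_differentiable fs2.
    rewrite -mulmxA -JE -deriveEjacobian // -(derive_dot _ _ dfs).2.
    have sw0 : \forall t \near (0 : 'rV[R]_2), dot ((f \o s) t) w = cst (0 : R) t.
      by apply: filterS sS.
    by rewrite (near_eq_derive _ sw0) derive_cst.
  split=> // a; first by rewrite first_ffE JE mulmxA.
  (* The tangent line of the section and [w] together span the tangent plane, so the normal space
     inside the hyperplane is that of the 3-manifold. *)
  have NE : orth_proj (Defs.normal_space (orthc w) (f \o s)) = normal_part.
    apply: eq_orth_proj; apply/eqmxP/andP; split; last first.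
      by rewrite sub_capmx !orthcS // JE submxMl.
    rewrite -[Defs.normal_space _ _]/(_ :&: _)%MS JE.
    have sub : ('J s 0 *m J + w <= J)%MS by rewrite addsmx_sub submxMl.
    have sJ : (J <= 'J s 0 *m J + w)%MS.
      rewrite -(geq_leqif (mxrank_leqif_sup sub)) f_rank.
      rewrite mxrank_disjoint_sum.
        (* Sylvester's inequality: the product has rank at least 2 + 2 - 3 = 1. *)
        have := mxrank_mul_min ('J s 0) J; rewrite rs f_rank rank_rV w0 => r1.
        by rewrite addn1 ltnS.
      apply/eqP; rewrite -submx0 -(cap_orthc w) capmxC capmxS // sub_orthc.
      apply/eqP/row_matrixP => i; rewrite row0 !rowE mulmxA mulmxA.
      exact/dot_eq0.
    rewrite sub_orthcC; apply: submx_trans sJ _; rewrite addsmx_sub.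
    by apply/andP; split; rewrite sub_orthcC; [exact: capmxSr|exact: capmxSl].
  rewrite second_ffE NE HE mulmxDl.
  by rewrite (normal_part_eq0 _).2 ?add0r // submxMl.
rewrite eqEsubset; split=> [y [s /key[sw sI sII] [a /= aI <-]]|_ [u /= [uw uI] <-]].
  by exists (a *m 'J s 0); rewrite ?sII //=; split; rewrite // -sI.
have [s sP] := surface_param_exists wT; exists s => //.
have [sw sI sII] := key s sP.
(* The row space of ['J s 0] lies in the kernel of [J *m w^T]; both have dimension 2, so they
   coincide. *)
have uS : (u <= 'J s 0)%MS.
  have wJ0 : J *m w^T != 0.
    have /submxP[b wE] := wJ; apply: contraNneq w0 => Jw0.
    by apply/eqP/dot_self_eq0/dot_eq0; rewrite {1}wE -mulmxA Jw0 mulmx0.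
  have rJw : \rank (J *m w^T) = 1%N.
    by apply/eqP; rewrite eqn_leq rank_leq_col lt0n mxrank_eq0.
  have sK : ('J s 0 <= kermx (J *m w^T))%MS.
    rewrite sub_kermx; apply/eqP/row_matrixP => i.
    by rewrite row0 rowE !mulmxA; exact/dot_eq0.
  have [_ _ rs _ _] := sP.
  have uK : (u <= kermx (J *m w^T))%MS by rewrite sub_kermx mulmxA; apply/eqP/dot_eq0.
  by apply: submx_trans uK _; rewrite -(geq_leqif (mxrank_leqif_sup sK)) mxrank_ker rJw rs.
have [a uE] := submxP uS.
by exists a; rewrite ?sII -?uE //= sI -uE.
Qed.

End NormalSectionLocus.

(** * Changes of coordinates *)

Section Jets.
Context {R : realType}.

Lemma hessZr n m (F : 'rV[R]_n -> 'rV[R]_m) a u v : hess F u (a *: v) = a *: hess F u v.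
Proof.
rewrite scaler_sumr; apply: eq_bigr => i _; rewrite scaler_sumr; apply: eq_bigr => j _.
by rewrite mxE scalerA mulrCA.
Qed.

Lemma hessZl n m (F : 'rV[R]_n -> 'rV[R]_m) a u v : hess F (a *: u) v = a *: hess F u v.
Proof.
rewrite scaler_sumr; apply: eq_bigr => i _; rewrite scaler_sumr; apply: eq_bigr => j _.
by rewrite mxE scalerA mulrA.
Qed.

Lemma hessDr n m (F : 'rV[R]_n -> 'rV[R]_m) u v w :
  hess F u (v + w) = hess F u v + hess F u w.
Proof.
rewrite -big_split; apply: eq_bigr => i _; rewrite -big_split; apply: eq_bigr => j _ /=.
by rewrite mxE mulrDr scalerDl.
Qed.

Lemma hessDl n m (F : 'rV[R]_n -> 'rV[R]_m) u v w :
  hess F (u + w) v = hess F u v + hess F w v.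
Proof.
rewrite -big_split; apply: eq_bigr => i _; rewrite -big_split; apply: eq_bigr => j _ /=.
by rewrite mxE mulrDl scalerDl.
Qed.

Lemma hess0l n m (F : 'rV[R]_n -> 'rV[R]_m) v : hess F 0 v = 0.
Proof. by rewrite -(scale0r 0) hessZl scale0r. Qed.

Lemma hess0r n m (F : 'rV[R]_n -> 'rV[R]_m) v : hess F v 0 = 0.
Proof. by rewrite -(scale0r 0) hessZr scale0r. Qed.

(* Symmetrising spares Schwarz's theorem: only [hess F u u] matters for the
   curvature locus. *)
Definition polar n m (F : 'rV[R]_n -> 'rV[R]_m) (u v : 'rV[R]_n) : 'rV[R]_m :=
  hess F u v + hess F v u.

Lemma polar_linear n m (F : 'rV[R]_n -> 'rV[R]_m) u a b v w :
  polar F u (a *: v + b *: w) = a *: polar F u v + b *: polar F u w.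
Proof.
by rewrite /polar hessDr hessDl !hessZr !hessZl !scalerDr addrACA.
Qed.

(** As [c] is 1 or -1, [t ^+ 2] equals [(c * t) ^+ 2]: the parameter [c * t] absorbs the sign, and
    both unit vectors trace the same curve. *)
Lemma hess_line n m (F : 'rV[R]_n -> 'rV[R]_m) (c t : R) u v : c ^+ 2 = 1 ->
  hess F (c *: u + t *: v) (c *: u + t *: v) =
    hess F u u + (c * t) *: polar F v u + (c * t) ^+ 2 *: hess F v v.
Proof.
move=> c2; rewrite /polar hessDr !hessDl !hessZr !hessZl !scalerA exprMn c2 mul1r.
by rewrite -!expr2 c2 scale1r scalerDr (mulrC t c) !addrA.
Qed.

(** Covers all six normal forms, in which every quadratic term is divisible by [z], the coordinate
    [k]. *)
Definition quadratic_map n m (L A : 'M[R]_(n, m)) (k : 'I_n) (u : 'rV[R]_n) : 'rV[R]_m :=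
  u *m L + u 0 k *: (u *m A).

(** The difference quotient is exactly [a + t *: b], which tends to [a]. *)
Lemma derive_quadratic n m (h : 'rV[R]_n -> 'rV[R]_m) (a b : 'rV[R]_m) (x v : 'rV[R]_n) :
  (forall t : R, h (t *: v + x) = h x + t *: a + t ^+ 2 *: b) -> 'D_v h x = a.
Proof.
move=> hE; apply: cvg_lim => //.
have c : (fun t : R => a + t *: b) @ 0^' --> a.
  have : {for (0 : R), continuous (fun t : R => a + t *: b)}.
    exact: differentiable_continuous.
  by move/continuous_withinNx; rewrite scale0r addr0.
apply: cvg_trans c; apply: near_eq_cvg; near=> t.
have t0 : t != 0 by near: t; exact: nbhs_dnbhs_neq.
rewrite /= hE -(addrA (h x)) (addrC (h x)) addrK scalerDr !scalerA mulVf // scale1r.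
by rewrite expr2 mulKf.
Unshelve. all: by end_near. Qed.

Lemma derive_quadratic_map n m (L A : 'M[R]_(n, m)) k u v :
  'D_v (quadratic_map L A k) u = v *m L + (u 0 k *: (v *m A) + v 0 k *: (u *m A)).
Proof.
apply: (@derive_quadratic _ _ _ _ (v 0 k *: (v *m A))) => t.
rewrite /quadratic_map !mulmxDl -!scalemxAl !mxE; apply/rowP => i; rewrite !mxE.
ring.
Qed.

Lemma quadratic_map_C2 n m (L A : 'M[R]_(n, m)) k : C2_germ (quadratic_map L A k).
Proof.
have dM (M : 'M[R]_(n, m)) x : differentiable (fun u : 'rV[R]_n => u *m M) x.
  exact: (@linear_differentiable _ _ _ (mulmxr M) x (@linear_rV_continuous R _ _ _)).
have dk x : differentiable (fun u : 'rV[R]_n => u 0 k) x by exact: differentiable_coord.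
split=> [|v].
  near=> x; apply: differentiableD; first exact: dM.
  exact: (derive_scale 0 (dk x) (dM A x)).1.
have -> : 'D_v (quadratic_map L A k) =
    (fun u => v *m L + (u 0 k *: (v *m A) + v 0 k *: (u *m A))).
  by apply/funext => u; exact: derive_quadratic_map.
apply: differentiableD; first exact: differentiable_cst.
apply: differentiableD; first exact: differentiableZl.
exact: differentiableZ.
Unshelve. all: by end_near. Qed.

Lemma hess_quadratic_map n m (L A : 'M[R]_(n, m)) k u v :
  hess (quadratic_map L A k) u v = u 0 k *: (v *m A) + v 0 k *: (u *m A).
Proof.
rewrite (hessE _ _ (quadratic_map_C2 L A k)).
apply: (@derive_quadratic _ _ _ _ 0) => t.
rewrite !derive_quadratic_map addr0 -!scalemxAl mul0mx; apply/rowP => i; rewrite !mxE.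
ring.
Qed.

Lemma row_jacobian n m (F : 'rV[R]_n -> 'rV[R]_m) x i :
  differentiable F x -> row i ('J F x) = partial i F x.
Proof. by move=> dF; rewrite rowE; apply/esym; exact: deriveEjacobian. Qed.

Lemma jet2_eq n m (F G : 'rV[R]_n -> 'rV[R]_m) : C2_germ F -> C2_germ G ->
  jet2 F = jet2 G -> 'J F 0 = 'J G 0 /\ hess F = hess G.
Proof.
move=> F2 G2 E.
have FG1 i : partial i F 0 = partial i G 0 := congr1 (fun p => p.1.2 i) E.
have FG2 i j : partial j (partial i F) 0 = partial j (partial i G) 0 :=
  congr1 (fun p => p.2 i j) E.
split.
  apply/row_matrixP => i; transitivity (partial i G 0).
    by rewrite -FG1; exact: row_jacobian (C2_germ_differentiable F2).
  exact/esym/(row_jacobian i (C2_germ_differentiable G2)).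
apply/funext => u; apply/funext => v; rewrite /hess.
by apply: eq_bigr => i _; apply: eq_bigr => j _; rewrite FG2.
Qed.

Lemma diffeo_germ_jacobian n (phi phi' : 'rV[R]_n -> 'rV[R]_n) :
  diffeo_germ phi phi' -> 'J phi 0 *m 'J phi' 0 = 1%:M.
Proof.
move=> [[s s'] [p0 p0'] id1 _].
have [c2 <- _] := hess_comp (smooth_germ_C2 s) p0 (smooth_germ_C2 s').
apply/row_matrixP => i; transitivity (partial i (phi' \o phi) 0).
  exact: row_jacobian (C2_germ_differentiable c2).
have id2 : \forall x \near (0 : 'rV[R]_n), (phi' \o phi) x = id x by [].
by rewrite /partial (near_eq_derive _ id2) derive_id row1.
Qed.

Lemma diffeo_germC n (phi phi' : 'rV[R]_n -> 'rV[R]_n) :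
  diffeo_germ phi phi' -> diffeo_germ phi' phi.
Proof. by case=> [[? ?] [? ?] ? ?]; split. Qed.

(* For [a] in the kernel of the first derivative of [h], the second derivatives
   of the diffeomorphisms contribute to [polar h a] only tangentially. *)
Lemma A2_equiv_polar n m (f h : 'rV[R]_n -> 'rV[R]_m) :
  C2_germ f -> f 0 = 0 -> C2_germ h -> A2_equiv f h ->
  exists2 P : 'M[R]_n, P \in unitmx &
    (forall a : 'rV[R]_n, a *m 'J h 0 = 0 <-> a *m P *m 'J f 0 = 0) /\
    (forall a b : 'rV[R]_n, a *m 'J h 0 = 0 ->
      ((polar h a b <= 'J h 0)%MS <-> (polar f (a *m P) (b *m P) <= 'J f 0)%MS)).
Proof.
move=> f2 f0 h2 [phi [phi' [psi [psi' [dphi dpsi jet]]]]].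
have PP := diffeo_germ_jacobian (diffeo_germC dphi).
have QQ := diffeo_germ_jacobian dpsi.
have [[_ sphi'] [_ phi'0] _ _] := dphi; have [[spsi _] [psi0 _] _ _] := dpsi.
set P := 'J phi' 0 in PP; set Q := 'J psi 0 in QQ; set J := 'J f 0.
have [c1 J1 H1] := hess_comp f2 f0 (smooth_germ_C2 spsi).
have [c2 J2 H2] := hess_comp (smooth_germ_C2 sphi') phi'0 c1.
have [] := jet2_eq c2 h2 jet; rewrite J2 J1 -/P -/Q -/J => Jh Hh.
have [Pu _] := mulmx1_unit PP; have [Qu _] := mulmx1_unit QQ.
have ker (a : 'rV[R]_n) : a *m 'J h 0 = 0 <-> a *m P *m J = 0.
  rewrite -Jh !mulmxA; split=> [aPJQ|->]; last exact: mul0mx.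
  by rewrite -(mulmxK Qu (a *m P *m J)) aPJQ mul0mx.
exists P; first exact: Pu.
split; first exact: ker.
move=> a b /ker aPJ.
(* The terms with the second derivative of [psi] have the argument [a *m P *m J = 0] and vanish;
   those with the second derivative of [phi'] pass through [J]. *)
have -> : polar h a b = (polar phi' a b *m J + polar f (a *m P) (b *m P)) *m Q.
  rewrite /polar -Hh !H2 !H1 -/P -/J aPJ hess0l hess0r !addr0 J1 -/Q -/J.
  by rewrite !mulmxDl !mulmxA addrACA.
have -> : ((polar phi' a b *m J + polar f (a *m P) (b *m P))%R *m Q <= 'J h 0)%MS =
    ((polar phi' a b *m J + polar f (a *m P) (b *m P))%R <= P *m J)%MS.
  rewrite -Jh mulmxA; apply/idP/idP => [/(submxMr (invmx Q))|sPJ]; last exact: (submxMr Q sPJ).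
  by rewrite !mulmxK.
have PJ : (P *m J :=: J)%MS by apply: eqmxMfull; rewrite row_full_unit.
rewrite PJ; split=> pJ; last exact: (addmx_sub (submxMl _ _) pJ).
rewrite -(addKr (polar phi' a b *m J) (polar f (a *m P) (b *m P))).
by apply: addmx_sub pJ; rewrite eqmx_opp; exact: submxMl.
Qed.

End Jets.

(** * Quadratic curves and their occurrence as normal sections *)

Section QuadraticCurves.
Context {R : realType} {m : nat}.
Implicit Types (a x y : 'rV[R]_m).

Definition quadratic_curve a x y : set 'rV[R]_m :=
  [set a + t *: x + t ^+ 2 *: y | t in [set: R]].

Lemma quadratic_curve_parabola a x y :
  (forall c d : R, c *: x + d *: y = 0 -> c = 0 /\ d = 0) ->
  nondegenerate_parabola (quadratic_curve a x y).
Proof.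
move=> xy; exists a, x, y; split=> //.
rewrite -kermx_eq0; apply/rowV0P => v; rewrite sub_kermx -[v]hsubmxK mul_row_col.
rewrite [lsubmx v]mx11_scalar [rsubmx v]mx11_scalar !mul_scalar_mx.
by move=> /eqP/xy[-> ->]; rewrite !raddf0 row_mx0.
Qed.

(** Completing the square puts the endpoint at parameter [- c / 2]; square roots show that the whole
    half-line is reached. *)
Lemma quadratic_curve_half_line a (c : R) y :
  y != 0 -> half_line (quadratic_curve a (c *: y) y).
Proof.
move=> y0; exists (a - (c ^+ 2 / 4) *: y), y; split=> //.
have E (t : R) : a + t *: (c *: y) + t ^+ 2 *: y =
    a - (c ^+ 2 / 4) *: y + (t + c / 2) ^+ 2 *: y.
  by apply/rowP => i; rewrite !mxE; field.
rewrite eqEsubset; split=> _ [t /= t0 <-].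
  by exists ((t + c / 2) ^+ 2); rewrite ?E //=; exact: sqr_ge0.
by exists (Num.sqrt t - c / 2) => //; rewrite E subrK sqr_sqrtr.
Qed.

Lemma quadratic_curve_line a x : x != 0 -> line (quadratic_curve a x 0).
Proof.
move=> x0; exists a, x; split=> //.
by rewrite eqEsubset; split=> _ [t _ <-]; exists t; rewrite ?scaler0 ?addr0.
Qed.

Lemma quadratic_curve_point a : single_point (quadratic_curve a 0 0).
Proof.
exists a; rewrite eqEsubset; split=> [_ [t _ <-]|_ ->].
  by rewrite /= !scaler0 !addr0.
by exists 0; rewrite ?scaler0 ?addr0.
Qed.

(** The points at parameters 0, 1 and -1 of a curve on one affine line determine [x] and [y] as
    multiples of its direction, contradicting their independence. Needed for the exceptional
    direction to be the only one. *)
Lemma parabola_not_half_line (C : set 'rV[R]_m) :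
  nondegenerate_parabola C -> ~ half_line C.
Proof.
move=> [a [x [y [xy ->]]]] [p [q [q0 E]]].
have inC t : exists s, a + t *: x + t ^+ 2 *: y = p + s *: q.
  have : [set p + s *: q | s in [set s : R | 0 <= s]] (a + t *: x + t ^+ 2 *: y).
    by rewrite -E; exists t.
  by case=> s _ <-; exists s.
have [s0 E0] := inC 0; have [s1 E1] := inC 1; have [s2 E2] := inC (-1).
have sub : (col_mx x y <= q)%MS.
  rewrite col_mx_sub; apply/andP; split; apply/sub_rVP.
    exists ((s1 - s2) / 2); apply/rowP => i.
    move: E1 E2 => /rowP/(_ i) + /rowP/(_ i); rewrite !mxE => E1 E2.
    suff : 2 * x 0 i = (s1 - s2) * q 0 i by lra.
    by lra.
  exists ((s1 + s2) / 2 - s0); apply/rowP => i.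
  move: E0 E1 E2 => /rowP/(_ i) + /rowP/(_ i) + /rowP/(_ i); rewrite !mxE => E0 E1 E2.
  by lra.
have := mxrankS sub; move/eqP: xy => ->.
by rewrite rank_rV leqNgt; case: (q != 0).
Qed.

Lemma line_not_single_point (C : set 'rV[R]_m) : line C -> ~ single_point C.
Proof.
move=> [a [b [b0 ->]]] [p E].
have inC t : a + t *: b = p.
  have : [set a + t *: b | t in [set: R]] (a + t *: b) by exists t.
  by rewrite E.
move/eqP: b0; apply; have := inC 1; rewrite -(inC 0) scale0r addr0 scale1r.
by move/eqP; rewrite addrC -subr_eq0 addrK => /eqP.
Qed.

End QuadraticCurves.

Lemma sum_ord3 (R : realType) (F : 'I_3 -> R) :
  \sum_(i < 3) F i = F 0 + F 1 + F ord_max.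
Proof.
rewrite !big_ord_recr big_ord0 /= add0r.
by congr (F _ + F _ + F _); exact: val_inj.
Qed.

Lemma row3P (R : realType) (u v : 'rV[R]_3) :
  u 0 0 = v 0 0 -> u 0 1 = v 0 1 -> u 0 ord_max = v 0 ord_max -> u = v.
Proof.
move=> uv0 uv1 uv2; apply/rowP => -[[|[|[|//]]] i3].
- by rewrite (_ : Ordinal i3 = 0) //; exact: val_inj.
- by rewrite (_ : Ordinal i3 = 1) //; exact: val_inj.
- by rewrite (_ : Ordinal i3 = ord_max) //; exact: val_inj.
Qed.

(** * Normal sections read off from the normal form *)

Section Sections.
Context {R : realType} (f : 'rV[R]_3 -> 'rV[R]_5).
Hypotheses (f_smooth : smooth_germ f) (f0 : f 0 = 0) (f_rank : \rank ('J f 0) = 2%N).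
Local Notation J := ('J f 0).
Local Notation N := (normal_part f).

Lemma tangent_dir_exists (v : 'rV[R]_5) : (v <= J)%MS -> v != 0 ->
  exists2 w, tangent_dir f w & dot w v = 0.
Proof.
by move=> vJ v0; have [w [wJ wv w0]] := plane_orthogonal f_rank v0 vJ; exists w.
Qed.

(** For a unit vector [u], the tangent plane contains a direction orthogonal to the nonzero vector
    [df u]; the section along it sees [u]. *)
Lemma union_of_sections_holds : union_of_sections f.
Proof.
rewrite /union_of_sections (curvature_locusE f); rewrite eqEsubset; split.
  move=> _ [u /= uI <-].
  have uJ0 : u *m J != 0.
    by apply/eqP => uJ0; move: uI; rewrite uJ0 dotE mul0mx mxE => /esym/eqP; rewrite oner_eq0.
  have [w wT wu] := tangent_dir_exists (submxMl u J) uJ0.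
  by exists w => //; rewrite section_parabolaE //; exists u => //=; rewrite dotC.
by move=> y [w wT]; rewrite section_parabolaE // => -[u /= [_ uI] <-]; exists u.
Qed.

Lemma section_parabola_curve w k e : tangent_dir f w ->
  (forall u : 'rV[R]_3, u *m J = 0 <-> (u <= k)%MS) ->
  dot (e *m J) w = 0 -> dot (e *m J) (e *m J) = 1 ->
  section_parabola f w =
  quadratic_curve (hess f e e *m N) (polar f k e *m N) (hess f k k *m N).
Proof.
move=> wT kP ew e1; have [w0 wJ] := wT; rewrite section_parabolaE //.
have kJ : k *m J = 0 by apply/kP.
have eJ0 : e *m J != 0.
  by apply/eqP => eJ0; move: e1; rewrite eJ0 dotE mul0mx mxE => /esym/eqP; rewrite oner_eq0.
have H c t : c ^+ 2 = 1 -> hess f (c *: e + t *: k) (c *: e + t *: k) *m N =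
    hess f e e *m N + (c * t) *: (polar f k e *m N) + (c * t) ^+ 2 *: (hess f k k *m N).
  by move=> c2; rewrite hess_line // 2!mulmxDl -!scalemxAl.
rewrite eqEsubset; split=> [_ [u /= [uw uI] <-]|_ [t _ <-]]; last first.
  exists (1 *: e + t *: k); last by rewrite (H 1 t (expr1n _ _)) mul1r.
  by rewrite /= mulmxDl -!scalemxAl kJ scaler0 addr0 scale1r.
(* Both vectors lie on the line of tangent vectors orthogonal to [w]; comparing lengths then gives
   [c ^+ 2 = 1]. *)
have /sub_rVP[c uE] : (u *m J <= e *m J)%MS.
  by apply: (plane_collinear f_rank w0 wJ) => //; exact: submxMl.
have c2 : c ^+ 2 = 1 by move: uI; rewrite uE dotZ e1 mulr1 expr2.
have /kP/sub_rVP[t ut] : (u - c *: e) *m J = 0 by rewrite mulmxBl uE -scalemxAl subrr.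
have -> : u = c *: e + t *: k by rewrite -ut addrC subrK.
by rewrite (H c t c2); exists (c * t).
Qed.

Variables (A : 'M[R]_(3, 5)).
Local Notation h := (quadratic_map (pid_mx 2) A ord_max).
Hypothesis A_normal : forall i (j : 'I_5), (j < 2)%N -> A i j = 0.

Lemma mul_pid_mx2 (u : 'rV[R]_3) :
  u *m (pid_mx 2 : 'M[R]_(3, 5)) = 0 <-> u 0 0 = 0 /\ u 0 1 = 0.
Proof.
split=> [/rowP u0|[u0 u1]]; last first.
  by apply/rowP => j; rewrite mxE sum_ord3 u0 u1 !mxE /= andbF !(mul0r, mulr0, addr0).
split; first by have := u0 0; rewrite mxE sum_ord3 !mxE /= !(mulr0, addr0, mulr1).
by have := u0 1; rewrite mxE sum_ord3 !mxE /= !(mulr0, addr0, add0r, mulr1).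
Qed.

(** The row space of [pid_mx 2], the tangent plane of the normal form, is spanned by the first two
    coordinate vectors, where [u *m A] has no component. *)
Lemma sub_pid_mx2 (u : 'rV[R]_3) :
  (u *m A <= (pid_mx 2 : 'M[R]_(3, 5)))%MS <-> u *m A = 0.
Proof.
split=> [/submxP[v E]|->]; last exact: sub0mx.
apply/rowP => j; rewrite [RHS]mxE; have [j2|j2] := ltnP j 2.
  by rewrite mxE sum_ord3 !A_normal // !mulr0 !addr0.
have /rowP/(_ j) := E => ->; rewrite mxE sum_ord3 !mxE /=.
by rewrite andbF; case: j j2 => -[|[|j]] //= _ _; rewrite !mulr0 !addr0.
Qed.

(* [l] gives the unit tangent vector orthogonal to [w], modulo the kernel of the
   differential, in the coordinates in which the 2-jet is the normal form. *)
Lemma section_normal_form : A2_equiv f h ->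
  exists2 w0, tangent_dir f w0 & forall w, tangent_dir f w ->
    exists l : 'rV[R]_3, exists a x y : 'rV[R]_5,
      [/\ l 0 0 != 0 \/ l 0 1 != 0, l 0 ord_max = 0,
          section_parabola f w = quadratic_curve a x y,
          (forall c d : R, c *: x + d *: y = 0 <->
            c *: (l *m A) + d *: row ord_max A = 0)
        & (w <= w0)%MS <-> l 0 0 = 0].
Proof.
move=> fh; have h2 := quadratic_map_C2 (pid_mx 2) A ord_max.
have [P Pu [kerP polP]] := A2_equiv_polar (smooth_germ_C2 f_smooth) f0 h2 fh.
have Jh : 'J h 0 = pid_mx 2.
  apply/row_matrixP => i; rewrite !rowE -deriveEjacobian; last exact: C2_germ_differentiable.
  by rewrite derive_quadratic_map mxE mul0mx scaler0 scale0r !addr0.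
rewrite Jh in kerP polP.
pose e3 : 'rV[R]_3 := delta_mx 0 ord_max; pose k := e3 *m P.
have [e3_0 e3_1 e3_2] : [/\ e3 0 0 = 0, e3 0 1 = 0 & e3 0 ord_max = 1] by rewrite !mxE.
have e3K : e3 *m (pid_mx 2 : 'M[R]_(3, 5)) = 0 by apply/mul_pid_mx2.
(* Coordinates in which the 2-jet is the normal form; there the kernel vector [k] is the third basis
   vector. *)
pose coor (u : 'rV[R]_3) := u *m invmx P.
have coorK u : coor u *m P = u by rewrite /coor mulmxKV.
have coor_k : coor k = e3 by rewrite /coor /k mulmxK.
have coorD a b u v : coor (a *: u + b *: v) = a *: coor u + b *: coor v.
  by rewrite /coor mulmxDl -!scalemxAl.
have kerJ0 (u : 'rV[R]_3) : u *m J = 0 <-> coor u 0 0 = 0 /\ coor u 0 1 = 0.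
  rewrite -mul_pid_mx2; split; first by rewrite -{1}(coorK u) => /kerP.
  by move=> /kerP; rewrite coorK.
have kerJ (u : 'rV[R]_3) : u *m J = 0 <-> (u <= k)%MS.
  split=> [|/sub_rVP[c ->]]; last by rewrite -scalemxAl (kerJ0 k).2 ?scaler0 // coor_k.
  move=> /kerJ0[u0 u1]; apply/sub_rVP; exists (coor u 0 ord_max).
  rewrite -{1}(coorK u) /k scalemxAl; congr (_ *m P).
  by apply: row3P; rewrite [RHS]mxE ?u0 ?u1 ?e3_0 ?e3_1 ?e3_2 ?mulr0 ?mulr1.
(* In the normal form the polar form with the kernel vector is twice the right-hand expression, and
   the factor 2 does not affect vanishing. *)
have polN (u : 'rV[R]_3) : polar f k u *m N = 0 <->
    coor u *m A + coor u 0 ord_max *: row ord_max A = 0.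
  have -> : coor u *m A + coor u 0 ord_max *: row ord_max A =
      (coor u + coor u 0 ord_max *: e3) *m A by rewrite mulmxDl -scalemxAl rowE.
  rewrite (normal_part_eq0 f) -{1}(coorK u) -(polP e3 (coor u) e3K) -sub_pid_mx2.
  have -> : polar h e3 (coor u) = 2 *: ((coor u + coor u 0 ord_max *: e3) *m A).
    rewrite /polar !hess_quadratic_map e3_2 mulmxDl -scalemxAl !scale1r.
    by rewrite scaler_nat mulr2n; congr (_ + _); exact: addrC.
  by rewrite (eqmx_scale _ (_ : (2 : R) != 0)) // pnatr_eq0.
pose e1 : 'rV[R]_3 := delta_mx 0 1.
have [e1_0 e1_1 e1_2] : [/\ e1 0 0 = 0, e1 0 1 = 1 & e1 0 ord_max = 0] by rewrite !mxE.
(* Image of the second coordinate vector. The distinguished direction [w0] is chosen orthogonal to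
   it, so that its section is the one with vanishing first coordinate. *)
pose d0 := e1 *m P *m J.
have d0_neq0 : d0 != 0.
  apply/eqP => /kerJ0; rewrite /coor mulmxK // => -[_].
  by rewrite mxE => /eqP; rewrite oner_eq0.
have [w0 [w0_neq0 w0J] w0d] := tangent_dir_exists (submxMl (e1 *m P) J) d0_neq0.
exists w0 => // w wT; have [w_neq0 wJ] := wT.
have [b [bJ bw b0]] := plane_orthogonal f_rank w_neq0 wJ.
have /submxP[u bE] := bJ.
have bb : 0 < dot b b.
  by rewrite lt_neqAle dot_ge0 andbT eq_sym; apply: contra_neq b0; exact: dot_self_eq0.
pose r := Num.sqrt (dot b b); have r0 : 0 < r by rewrite sqrtr_gt0.
(* Dividing by [r] gives unit length; the multiple of [k] removes the third coordinate without
   changing the image. *)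
pose e := r^-1 *: u + (- (r^-1 * coor u 0 ord_max)) *: k.
have kJ : k *m J = 0 by apply/kerJ.
have eJ : e *m J = r^-1 *: b by rewrite mulmxDl -!scalemxAl kJ scaler0 addr0 -bE.
have ew : dot (e *m J) w = 0 by rewrite eJ -[w]scale1r dotZ bw mulr0.
have ee : dot (e *m J) (e *m J) = 1.
  by rewrite eJ dotZ -[dot b b]sqr_sqrtr ?ltW // -/r expr2 mulrACA mulVf ?mulr1 // gt_eqF.
have eJ0 : e *m J != 0 by rewrite eJ scaler_eq0 invr_eq0 negb_or b0 gt_eqF.
have l2 : coor e 0 ord_max = 0.
  by rewrite coorD coor_k mxE [X in X + _]mxE [X in _ + X]mxE e3_2 mulr1 addrN.
exists (coor e), (hess f e e *m N), (polar f k e *m N), (hess f k k *m N); split=> //.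
- have [l0|] := eqVneq (coor e 0 0) 0; last by left.
  right; apply: contraNneq eJ0 => l1; exact/eqP/kerJ0.
- exact: section_parabola_curve.
- move=> c d.
  have lin (p q : 'rV[R]_5) : c *: (p *m N) + d *: (q *m N) = (c *: p + d *: q) *m N.
    by rewrite mulmxDl -!scalemxAl.
  (* Since [polar f k k] is twice [hess f k k], the coefficient of [k] is [d / 2]; the two terms of
     [polN] restore [d]. *)
  have -> : c *: (polar f k e *m N) + d *: (hess f k k *m N) =
      polar f k (c *: e + (d / 2) *: k) *m N.
    rewrite lin (polar_linear f k c (d / 2) e k); congr ((_ + _) *m N).
    by rewrite /polar; move: (hess f k k) => v; apply/rowP => i; rewrite !mxE; field.
  rewrite polN coorD coor_k mulmxDl -!scalemxAl -rowE.
  have -> : (c *: coor e + (d / 2) *: e3) 0 ord_max = d / 2.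
    by rewrite mxE [X in X + _]mxE [X in _ + X]mxE l2 e3_2 mulr0 add0r mulr1.
  by rewrite -addrA -scalerDl -splitr.
(* In the tangent plane, [w] is parallel to [w0] exactly when the orthogonal vector [e *m J] is
   parallel to [d0], that is, when the first coordinate of [e] vanishes. *)
- split=> [ww0|l0].
    have ew0 : dot (e *m J) w0 = 0.
      have /sub_rVP[c wE] := ww0; move: ew; rewrite wE -[e *m J]scale1r dotZ mul1r.
      move/eqP; rewrite mulf_eq0 => /orP[/eqP c0|/eqP]; last by rewrite scale1r.
      by move: w_neq0; rewrite wE c0 scale0r eqxx.
    have /sub_rVP[c eE] : (e *m J <= d0)%MS.
      apply: (plane_collinear f_rank w0_neq0 w0J) => //; try exact: submxMl.
      by rewrite dotC.
    have /kerJ0[] : (1 *: e + (- c) *: (e1 *m P)) *m J = 0.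
      by rewrite mulmxDl -!scalemxAl eE -/d0 scale1r scaleNr addrN.
    by rewrite coorD scale1r /coor mulmxK // !mxE mulr0 addr0.
  have l1 : coor e 0 1 != 0 by apply: contraNneq eJ0 => l1; exact/eqP/kerJ0.
  have eE : e *m J = coor e 0 1 *: d0.
    rewrite /d0 !scalemxAl -{1}(coorK e); congr (_ *m _ *m _).
    by apply: row3P; rewrite [RHS]mxE ?e1_0 ?e1_1 ?e1_2 ?l0 ?l2 ?mulr0 ?mulr1.
  apply: (plane_collinear f_rank d0_neq0 (submxMl _ _)) => //.
  move: ew; rewrite eE -[w]scale1r dotZ mulr1 => /eqP.
  by rewrite mulf_eq0 (negPf l1) scale1r dotC => /eqP.
Qed.

End Sections.

(** * Normal forms *)

Section NormalForms.
Context {R : realType}.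

(* Coefficients of [z] in the last three components: each is [z] times the
   linear form with coefficients [a`_i], [b`_i], [c`_i] in [x], [y], [z]. *)
Definition normal_form_mx (a b c : seq R) : 'M[R]_(3, 5) :=
  \matrix_(i < 3, j < 5) if (j < 2)%N then 0 else (nth [::] [:: a; b; c] i)`_(j - 2).

Definition normal_form (a b c : seq R) : 'rV[R]_3 -> 'rV[R]_5 :=
  quadratic_map (pid_mx 2) (normal_form_mx a b c) ord_max.

(** Coefficient lists may be short: missing entries read as 0. *)
Lemma normal_formE (a b c : seq R) (G : R -> R -> R -> seq R) :
  (forall x y z, G x y z = [:: x; y; z * (a`_0 * x + b`_0 * y + c`_0 * z);
     z * (a`_1 * x + b`_1 * y + c`_1 * z); z * (a`_2 * x + b`_2 * y + c`_2 * z)]) ->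
  map35 G = normal_form a b c.
Proof.
move=> GE; apply/funext => u; apply/rowP => j.
rewrite !mxE !sum_ord3 GE !mxE.
by case: j => [[|[|[|[|[|//]]]]] j5] /=; rewrite ?sub0n ?subSS ?subn0 /=; ring.
Qed.

(** The vectors [x] and [y] satisfy the same linear relations as [s a + t b] and [c]; with [(s, t)]
    nonzero, this decides the type of the curve. *)
Lemma normal_form_sections (f : 'rV[R]_3 -> 'rV[R]_5) (a b c : seq R) :
  smooth_germ f -> f 0 = 0 -> \rank ('J f 0) = 2%N -> A2_equiv f (normal_form a b c) ->
  exists2 w0, tangent_dir f w0 & forall w, tangent_dir f w ->
    exists (s t : R) (p x y : 'rV[R]_5),
      [/\ s != 0 \/ t != 0, section_parabola f w = quadratic_curve p x y,
          (forall g d : R, g *: x + d *: y = 0 <->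
             forall i, (i < 3)%N -> g * (s * a`_i + t * b`_i) + d * c`_i = 0)
        & (w <= w0)%MS <-> s = 0].
Proof.
move=> f_smooth f0 f_rank fh.
have A_normal i (j : 'I_5) : (j < 2)%N -> normal_form_mx a b c i j = 0.
  by move=> j2; rewrite mxE j2.
have [w0 w0T sec] := section_normal_form f_smooth f0 f_rank A_normal fh.
exists w0 => // w wT; have [l [p [x [y [l0 l2 E xy w_w0]]]]] := sec w wT.
exists (l 0 0), (l 0 1), p, x, y; split=> // g d; rewrite xy; split=> [/rowP E0 i i3|E0].
  have i5 : (i.+2 < 5)%N by rewrite !ltnS.
  have := E0 (Ordinal i5); rewrite !mxE sum_ord3 !mxE /= l2 mul0r addr0.
  by rewrite subn2.
apply/rowP => j; rewrite !mxE sum_ord3 !mxE /= l2 mul0r addr0.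
have [j2|j2] := ltnP j 2; first by rewrite !mulr0 !addr0 mulr0.
by apply: E0; rewrite ltn_subLR.
Qed.

End NormalForms.

Unset Implicit Arguments.
Set Strict Implicit.

Theorem theorem3p5 (R : realType) (f : 'rV[R]_3 -> 'rV[R]_5)
    (f_smooth : smooth_germ f) (f_origin : f 0 = 0)
    (f_corank1 : \rank ('J f 0) = 2%N) :
  (A2_equiv f (map35 (fun x y z => [:: x; y; x * z; y * z; z ^+ 2])) ->
     generated_exclusively f nondegenerate_parabola) /\
  (A2_equiv f (map35 (fun x y z => [:: x; y; z ^+ 2; x * z; 0])) ->
     generated_by f nondegenerate_parabola half_line) /\
  (A2_equiv f (map35 (fun x y z => [:: x; y; x * z; y * z; 0])) ->
     generated_exclusively f line) /\
  (A2_equiv f (map35 (fun x y z => [:: x; y; z ^+ 2; 0; 0])) ->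
     generated_exclusively f half_line) /\
  (A2_equiv f (map35 (fun x y z => [:: x; y; x * z; 0; 0])) ->
     generated_by f line single_point) /\
  (A2_equiv f (map35 (fun x y z => [:: x; y; 0; 0; 0])) ->
     generated_exclusively f single_point).
Proof.
have U := union_of_sections_holds f_smooth f_origin f_corank1.
have sec := normal_form_sections f_smooth f_origin f_corank1.
(* Vanishing of a single vector, phrased as a linear relation so that it can be read off from the
   coefficients. *)
have zero (x y : 'rV[R]_5) : (x = 0 <-> 1 *: x + 0 *: y = 0) /\ (y = 0 <-> 0 *: x + 1 *: y = 0).
  by rewrite !scale1r !scale0r addr0 add0r.
split; [|split; [|split; [|split; [|split]]]].
(* The relations are [g * s = 0], [g * t = 0], [d = 0], hence trivial because [(s, t)] is
   nonzero. *)
- rewrite (@normal_formE _ [:: 1] [:: 0; 1] [:: 0; 0; 1]); last first.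
    by move=> x y z /=; congr [:: _; _; _; _; _]; ring.
  move=> /sec[w0 _ {}sec]; split=> // w /sec[s [t [p [x [y [st -> xy _]]]]]].
  apply: quadratic_curve_parabola => g d /xy E.
  have := (E 0%N isT, E 1%N isT, E 2%N isT) => /=.
  rewrite !(mulr0, mulr1, addr0, add0r) => -[[gs gt] ->]; split=> //.
  by case: st => [s0|t0]; apply/eqP; [move/eqP: gs|move/eqP: gt];
    rewrite mulf_eq0 ?(negPf s0) ?(negPf t0) orbF.
(* The relations are [d = 0] and [g * s = 0]: independence for nonzero [s], while [s = 0], the
   direction [w0], forces [x = 0] with [y] nonzero. *)
- rewrite (@normal_formE _ [:: 0; 1] [::] [:: 1]); last first.
    by move=> x y z /=; congr [:: _; _; _; _; _]; ring.
  move=> /sec[w0 w0T {}sec]; split=> //; exists w0 => // w /sec[s [t [p [x [y [st -> xy ww0]]]]]].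
  have {}xy g d : g *: x + d *: y = 0 <-> d = 0 /\ g * s = 0.
    rewrite xy; split=> [E|[d0 gs]].
      by have := (E 0%N isT, E 1%N isT) => /=; rewrite !(mulr0, mulr1, addr0, add0r) => -[].
    by move=> [|[|[|//]]] _ /=; rewrite !(mulr0, mulr1, addr0, add0r).
  have par : s != 0 -> nondegenerate_parabola (quadratic_curve p x y).
    move=> s0; apply: quadratic_curve_parabola => g d /xy[-> /eqP].
    by rewrite mulf_eq0 (negPf s0) orbF => /eqP.
  have half : s = 0 -> half_line (quadratic_curve p x y).
    move=> s0; have -> : x = 0 *: y.
      by rewrite scale0r; apply/(zero x y).1/xy; rewrite s0 mulr0.
    apply: quadratic_curve_half_line; apply/eqP => /(zero x y).2/xy[/eqP].
    by rewrite oner_eq0.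
  rewrite ww0; split; last by move=> /negP w_w0; apply: par; apply/eqP => /ww0.
  split=> // hl; apply/eqP; apply/negPn/negP => /par /parabola_not_half_line; exact.
(* Here [y = 0], and [x] is nonzero because [(s, t)] is. *)
- rewrite (@normal_formE _ [:: 1] [:: 0; 1] [::]); last first.
    by move=> x y z /=; congr [:: _; _; _; _; _]; ring.
  move=> /sec[w0 _ {}sec]; split=> // w /sec[s [t [p [x [y [st -> xy _]]]]]].
  have -> : y = 0.
    by apply/(zero x y).2/xy => -[|[|[|//]]] _ /=; rewrite !(mul0r, mulr0, addr0).
  apply: quadratic_curve_line; apply/eqP => /(zero x y).1/xy E.
  have := (E 0%N isT, E 1%N isT) => /=; rewrite !(mulr0, mulr1, mul1r, addr0, add0r) => -[s0 t0].
  by case: st; rewrite ?s0 ?t0 eqxx.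
(* The only relation is [d = 0], so [x = 0] and [y] is nonzero. *)
- rewrite (@normal_formE _ [::] [::] [:: 1]); last first.
    by move=> x y z /=; congr [:: _; _; _; _; _]; ring.
  move=> /sec[w0 _ {}sec]; split=> // w /sec[s [t [p [x [y [st -> xy _]]]]]].
  have -> : x = 0 *: y.
    by rewrite scale0r; apply/(zero x y).1/xy => -[|[|[|//]]] _ /=;
      rewrite !(mul0r, mulr0, addr0).
  apply: quadratic_curve_half_line; apply/eqP => /(zero x y).2/xy/(_ 0%N isT) /=.
  by rewrite !(mul0r, mulr1, add0r) => /eqP; rewrite oner_eq0.
(* Here [y = 0], and [x] vanishes exactly for [s = 0], the direction [w0]. *)
- rewrite (@normal_formE _ [:: 1] [::] [::]); last first.
    by move=> x y z /=; congr [:: _; _; _; _; _]; ring.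
  move=> /sec[w0 w0T {}sec]; split=> //; exists w0 => // w /sec[s [t [p [x [y [st -> xy ww0]]]]]].
  have {}xy g d : g *: x + d *: y = 0 <-> g * s = 0.
    rewrite xy; split=> [/(_ 0%N isT)|gs] /=; first by rewrite !(mulr0, mulr1, addr0).
    by move=> [|[|[|//]]] _ /=; rewrite !(mulr0, mulr1, addr0).
  have -> : y = 0 by apply/(zero x y).2/xy; rewrite mul0r.
  have ln : s != 0 -> line (quadratic_curve p x 0).
    move=> s0; apply: quadratic_curve_line; apply/eqP => /(zero x y).1/xy/eqP.
    by rewrite mul1r (negPf s0).
  have pt : s = 0 -> single_point (quadratic_curve p x 0).
    move=> s0; have -> : x = 0 by apply/(zero x y).1/xy; rewrite s0 mulr0.
    exact: quadratic_curve_point.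
  rewrite ww0; split; last by move=> /negP w_w0; apply: ln; apply/eqP => /ww0.
  split=> // sp; apply/eqP; apply/negPn/negP => /ln /line_not_single_point; exact.
- rewrite (@normal_formE _ [::] [::] [::]); last first.
    by move=> x y z /=; congr [:: _; _; _; _; _]; ring.
  move=> /sec[w0 _ {}sec]; split=> // w /sec[s [t [p [x [y [st -> xy _]]]]]].
  have {}xy g d : g *: x + d *: y = 0.
    by apply/xy => i _; rewrite !nth_nil !(mulr0, addr0).
  have -> : x = 0 by apply/(zero x y).1.
  have -> : y = 0 by apply/(zero x y).2.
  exact: quadratic_curve_point.
Qed.
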